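(* Let $K$ be a field and let $R$ be a Koszul standard graded commutative $K$-algebra. Then for every $c\in\mathbb N$ one has: (1) the Veronese subalgebra $R^{(c)}$ is Koszul; (2) $\operatorname{reg}_{R^{(c)}}(V_u)=0$ for every $u=0,\dots,c-1$, i.e. the Veronese submodules $V_u$ of $R$ have a linear resolution over $R^{(c)}$.
   Context: A standard graded $K$-algebra is a commutative $K$-algebra $R=\bigoplus_{i\ge 0}R_i$ with $R_0=K$, $\dim_K R_1<\infty$ and $R_iR_j=R_{i+j}$ for all $i,j\ge 0$. The field $K=R/\bigoplus_{i>0}R_i$ is regarded as a graded $R$-module. Modules are graded and finitely generated. For a standard graded $K$-algebra $A$ and a finitely generated graded $A$-module $M$, put $\beta^A_{ij}(M)=\dim_K\operatorname{Tor}_i^A(M,K)_j$ and $\operatorname{reg}_A(M)=\sup\{j-i:\beta^A_{ij}(M)\ne 0\}$. The module $M$ has a linear resolution over $A$ if for some $d\in\mathbb Z$ one has $\beta_{ij}^A(M)=0$ whenever $j\ne d+i$. The algebra $A$ is Koszul if $\operatorname{reg}_A(K)=0$, i.e. $\beta^A_{ij}(K)=0$ whenever $i\ne j$. The $c$-th Veronese subalgebra of $R$ is $R^{(c)}=\bigoplus_{j\in\mathbb Z}R_{jc}$, regarded as a standard graded $K$-algebra whose degree $j$ component is $R_{jc}$. For $u=0,\dots,c-1$ the Veronese submodule is $V_u=\bigoplus_{j\in\mathbb Z}R_{jc+u}$, a graded $R^{(c)}$-module whose degree $j$ component is $R_{jc+u}$.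
   Formalization: The equality reg(V_u)=0 is stated for nonzero V_u only (for R=K[x]/(x^2), c=3, u=2 one has V_u=0 and the supremum defining reg is over the empty set); that V_u has a linear resolution is stated for every u=0,...,c-1, and c is taken to be at least 1. *)

(* Defs.v *)
From HB Require Import structures.
From mathcomp Require Import all_boot all_order all_algebra.
From mathcomp Require Import boolp classical_sets constructive_ereal.
Set Implicit Arguments.
Unset Strict Implicit.
Unset Printing Implicit Defensive.
Import Order.TTheory GRing.Theory Num.Theory.
Local Open Scope ring_scope.

(* A graded object is given by the Z-indexed family of its components.        *)
(* Multiplications take a proof of i + j = k instead of landing in the        *)
(* component of index i + j: such proofs are unique, and no transport is      *)
(* needed to state associativity, or to re-index (Veronese, shifts).          *)
Record gralg (K : fieldType) := GrAlg {
  gr :> int -> lmodType K;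
  gone : gr 0;
  gmul : forall i j k : int, i + j = k -> gr i -> gr j -> gr k;
  gmul_linear : forall i j k (e : i + j = k) (x : gr i), linear (gmul e x);
  gmulC : forall i j k (e : i + j = k) (e' : j + i = k) (x : gr i) (y : gr j),
    gmul e x y = gmul e' y x;
  gmulA : forall i j l ij jl m (e1 : i + j = ij) (e2 : ij + l = m)
      (e3 : j + l = jl) (e4 : i + jl = m) (x : gr i) (y : gr j) (z : gr l),
    gmul e2 (gmul e1 x y) z = gmul e4 x (gmul e3 y z);
  gmul1 : forall i (e : 0 + i = i) (x : gr i), gmul e gone x = x
}.
Arguments gone {K} g.
Arguments gmul {K} g {i j k}.

(* deg0 is the identification R_0 = K, inverse to a |-> a *: 1.               *)
Record stdgr (K : fieldType) := StdGr {
  sgalg :> gralg K;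
  sg_neg : forall i : int, i < 0 -> forall x : sgalg i, x = 0;
  deg0 : sgalg 0 -> K;
  deg0K : forall x : sgalg 0, deg0 x *: gone sgalg = x;
  deg0Z : forall a : K, deg0 (a *: gone sgalg) = a;
  sg_fin : exists (n : nat) (v : 'I_n -> sgalg 1), forall x : sgalg 1,
    exists a : 'I_n -> K, x = \sum_t a t *: v t;
  sg_gen : forall (i j k : int) (e : i + j = k), 0 <= i -> 0 <= j ->
    forall z : sgalg k, exists (n : nat) (x : 'I_n -> sgalg i)
      (y : 'I_n -> sgalg j), z = \sum_t gmul sgalg e (x t) (y t)
}.

Record grmod (K : fieldType) (A : gralg K) := GrMod {
  gm :> int -> lmodType K;
  gact : forall i j k : int, i + j = k -> A i -> gm j -> gm k;
  gact_linear : forall i j k (e : i + j = k) (x : A i), linear (gact e x);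
  gact_linearl : forall i j k (e : i + j = k) (m : gm j),
    linear (fun x : A i => gact e x m);
  gactA : forall i j l ij jl k (e1 : i + j = ij) (e2 : ij + l = k)
      (e3 : j + l = jl) (e4 : i + jl = k) (x : A i) (y : A j) (m : gm l),
    gact e2 (gmul A e1 x y) m = gact e4 x (gact e3 y m);
  gact1 : forall i (e : 0 + i = i) (m : gm i), gact e (gone A) m = m
}.
Arguments gact {K A} g {i j k}.

(* The degree j component of the free module \bigoplus_k A(- d k).            *)
Definition grfree (K : fieldType) (A : gralg K) n (d : 'I_n -> int) (j : int) :=
  forall k : 'I_n, A (j - d k).

(* The degree 0 map between free modules sending the k-th basis vector to     *)
(* \sum_l phi k l * (l-th basis vector).                                      *)
Definition frmap (K : fieldType) (A : gralg K) n' n (d' : 'I_n' -> int)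
    (d : 'I_n -> int) (phi : forall k l, A (d' k - d l)) (j : int)
    (x : grfree A d' j) : grfree A d j :=
  fun l => \sum_k gmul A (subrKA (d' k) j (- d l)) (x k) (phi k l).

Definition fraug (K : fieldType) (A : gralg K) (M : grmod A) n
    (d : 'I_n -> int) (g : forall k, M (d k)) (j : int) (x : grfree A d j) :
  M j := \sum_k gact M (subrK (d k) j) (x k) (g k).

(* Resolutions  ... -> F_1 -> F_0 -> M -> 0  by finitely generated graded     *)
(* free modules, F_i = \bigoplus_(k < frk i) A(- fdeg k); not necessarily     *)
(* minimal.                                                                   *)
Record grres (K : fieldType) (A : gralg K) (M : grmod A) := GrRes {
  frk : nat -> nat;
  fdeg : forall i, 'I_(frk i) -> int;
  fdiff : forall i (k : 'I_(frk i.+1)) (l : 'I_(frk i)), A (fdeg k - fdeg l);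
  fgen : forall k : 'I_(frk 0), M (fdeg k);
  fsurj : forall j (m : M j),
    exists x : grfree A (@fdeg 0%N) j, fraug fgen x = m;
  fexact0 : forall j (x : grfree A (@fdeg 0%N) j),
    fraug fgen x = 0 <->
    exists y : grfree A (@fdeg 1%N) j, forall l, frmap (@fdiff 0%N) y l = x l;
  fexact : forall i j (x : grfree A (@fdeg i.+1) j),
    (forall l, frmap (@fdiff i) x l = 0) <->
    exists y : grfree A (@fdeg i.+2) j, forall l, frmap (@fdiff i.+1) y l = x l
}.
Arguments fdeg {K A M} g i.
Arguments fdiff {K A M} g i.

Section Augmentation.
Variables (K : fieldType) (A : stdgr K).

(* The algebra map A -> A / A_+ = K, on the component of degree i.            *)
Definition aug (i : int) (x : A i) : K :=
  if i =P 0 is ReflectT e then deg0 (ecast i (A i) e x) else 0.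

Lemma deg0_linear : linear (@deg0 K A : A 0 -> K^o).
Proof.
move=> a x y; rewrite -{1}(deg0K x) -{1}(deg0K y) scalerA -scalerDl deg0Z.
by [].
Qed.

Lemma gmul_linearl (i j k : int) (e : i + j = k) (y : A j) :
  linear (fun x : A i => gmul A e x y).
Proof.
have e' : j + i = k by rewrite addrC.
by move=> a x x'; rewrite !(gmulC e e') gmul_linear.
Qed.

Lemma gmul0 (i j k : int) (e : i + j = k) (x : A i) : gmul A e x 0 = 0.
Proof.
have := gmul_linear e x (-1) 0 0.
by rewrite !scaleN1r oppr0 addr0 addNr.
Qed.

Lemma gmul0l (i j k : int) (e : i + j = k) (y : A j) : gmul A e 0 y = 0.
Proof. by rewrite (gmulC e (etrans (addrC j i) e)) gmul0. Qed.

Lemma gmulZ (i j k : int) (e : i + j = k) (x : A i) a (y : A j) :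
  gmul A e x (a *: y) = a *: gmul A e x y.
Proof. by have := gmul_linear e x a y 0; rewrite gmul0 !addr0. Qed.

Lemma gmulZl (i j k : int) (e : i + j = k) (x : A i) a (y : A j) :
  gmul A e (a *: x) y = a *: gmul A e x y.
Proof. by have := gmul_linearl e y a x 0; rewrite gmul0l !addr0. Qed.

Lemma gmul_sum (i j k : int) (e : i + j = k) (x : A i) (I : finType)
    (f : I -> A j) : gmul A e x (\sum_t f t) = \sum_t gmul A e x (f t).
Proof.
elim/big_rec2: _ => [|t y1 y2 _ <-]; first exact: gmul0.
by have := gmul_linear e x 1 (f t) y2; rewrite !scale1r.
Qed.

Lemma gmul_suml (i j k : int) (e : i + j = k) (y : A j) (I : finType)
    (f : I -> A i) : gmul A e (\sum_t f t) y = \sum_t gmul A e (f t) y.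
Proof.
have e' : j + i = k by rewrite addrC.
by rewrite (gmulC e e') gmul_sum; apply: eq_bigr => t _; rewrite (gmulC e e').
Qed.

Lemma aug0 (x : A 0) : aug x = deg0 x.
Proof. by rewrite /aug; case: eqP => // p; rewrite (eq_irrelevance p erefl). Qed.

Lemma augN0 (i : int) (x : A i) : i != 0 -> aug x = 0.
Proof. by rewrite /aug; case: eqP. Qed.

Lemma aug_linear (i : int) : linear (@aug i : A i -> K^o).
Proof.
have [->|i0] := eqVneq i 0; last first.
  by move=> a x y; rewrite !augN0 // scaler0 addr0.
by move=> a x y; rewrite !aug0 // deg0_linear.
Qed.

Lemma aug1 : aug (gone A) = 1.
Proof. by rewrite aug0 // -[gone A]scale1r deg0Z. Qed.

Lemma augM (i j k : int) (e : i + j = k) (x : A i) (y : A j) :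
  aug (gmul A e x y) = aug x * aug y.
Proof.
have aug_0 l : aug (0 : A l) = 0.
  by have := @aug_linear l (-1) 0 0; rewrite !scaleN1r oppr0 addr0 addNr.
have [i0|i0] := eqVneq i 0; last first.
  rewrite (augN0 x) // mul0r.
  have [k0|k0] := eqVneq k 0; last by rewrite augN0.
  have [i_lt0|i_ge0] := ltP i 0.
    by rewrite (sg_neg i_lt0 x) gmul0l aug_0.
  have j_lt0 : j < 0.
    have -> : j = - i by apply/eqP; rewrite -addr_eq0 addrC e k0.
    by rewrite oppr_lt0 lt_def i0.
  by rewrite (sg_neg j_lt0 y) gmul0 aug_0.
subst i; have jk : j = k by rewrite -e add0r.
case: k / jk e => e; rewrite (aug0 x) -{1}(deg0K x) gmulZl gmul1.
by have := aug_linear (deg0 x) y 0; rewrite addr0 aug_0 addr0 => ->.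
Qed.

(* The graded module K = A / A_+: its component of degree j is K if j = 0     *)
(* and 0 otherwise, as row vectors of length j == 0.                          *)
Definition resfield_act (i j k : int) (e : i + j = k) (x : A i)
    (v : 'rV[K]_(j == 0)) : 'rV[K]_(k == 0) := aug x *: conform_mx 0 v.

Fact resfield_act_linear i j k (e : i + j = k) (x : A i) :
  linear (resfield_act e x).
Proof.
move=> a v w; rewrite /resfield_act.
have [i0|i0] := eqVneq i 0; last by rewrite augN0 // !scale0r scaler0 addr0.
have jk : j = k by rewrite -e i0 add0r.
by case: k / jk e => _; rewrite !conform_mx_id scalerDr !scalerA mulrC.
Qed.

Fact resfield_act_linearl i j k (e : i + j = k) (v : 'rV[K]_(j == 0)) :
  linear (fun x : A i => resfield_act e x v).
Proof.
by move=> a x y; rewrite /resfield_act aug_linear scalerDl scalerA.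
Qed.

Fact resfield_actA i j l ij jl k (e1 : i + j = ij) (e2 : ij + l = k)
    (e3 : j + l = jl) (e4 : i + jl = k) (x : A i) (y : A j)
    (v : 'rV[K]_(l == 0)) :
  resfield_act e2 (gmul A e1 x y) v = resfield_act e4 x (resfield_act e3 y v).
Proof.
rewrite /resfield_act augM.
have [i0|i0] := eqVneq i 0; last by rewrite (augN0 x) // mul0r !scale0r.
have [j0|j0] := eqVneq j 0; last first.
  rewrite (augN0 y) // mulr0 !scale0r.
  have jk : jl = k by rewrite -e4 i0 add0r.
  by case: k / jk {e2 e4} => //; rewrite conform_mx_id scaler0.
have lj : l = jl by rewrite -e3 j0 add0r.
have jk : jl = k by rewrite -e4 i0 add0r.
by case: k / jk {e2 e4}; case: jl / lj {e3}; rewrite !conform_mx_id scalerA.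
Qed.

Fact resfield_act1 i (e : 0 + i = i) (v : 'rV[K]_(i == 0)) :
  resfield_act e (gone A) v = v.
Proof. by rewrite /resfield_act aug1 scale1r conform_mx_id. Qed.

Definition resfield : grmod A :=
  @GrMod K A (fun j => 'rV[K]_(j == 0)) resfield_act resfield_act_linear
    resfield_act_linearl resfield_actA resfield_act1.

End Augmentation.

Section Betti.
Variables (K : fieldType) (A : stdgr K) (M : grmod A).

(* The complex F (x)_A K has the term K^(frk i) in homological degree i, with *)
(* basis in the internal degrees fdeg F i; tordiff is its differential,       *)
(* acting on row vectors.                                                     *)
Definition tordiff (F : grres M) i : 'M[K]_(frk F i.+1, frk F i) :=
  \matrix_(k, l) aug (fdiff F i k l).

Definition torstrand (F : grres M) i (j : int) : 'M[K]_(frk F i) :=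
  diag_mx (\row_k (fdeg F i k == j)%:R).

Definition torcycles (F : grres M) i : 'M[K]_(frk F i) :=
  if i is i'.+1 then kermx (tordiff F i') else 1%:M.

(* dim_K H_i(F (x)_A K)_j = dim (cycles) - dim (boundaries)                   *)
Definition tordim (F : grres M) i (j : int) : nat :=
  (\rank (torcycles F i :&: torstrand F i j)%MS
   - \rank (torstrand F i.+1 j *m tordiff F i))%N.

(* beta_ij(M) = dim_K Tor_i^A(M, K)_j, with Tor computed from a graded free   *)
(* resolution; as A is Noetherian, one exists when M is finitely generated    *)
(* (and otherwise betti is set to 0).                                         *)
Definition betti i (j : int) : nat :=
  if pselect $|grres M| is left F then tordim (unsquash F) i j else 0%N.

(* The supremum is taken in int extended with -oo (empty set) and +oo.        *)
Definition reg : \bar int :=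
  supremum -oo%E
    [set z | exists i j, betti i j <> 0%N /\ z = (j - i%:Z)%:E]%classic.

Definition linear_resolution : Prop :=
  exists d : int, forall (i : nat) (j : int), j <> d + i%:Z -> betti i j = 0%N.

Definition nonzero_mod : Prop := exists (j : int) (m : M j), m <> 0.

End Betti.

Definition koszul (K : fieldType) (A : stdgr K) : Prop :=
  reg (resfield A) = 0%E.

Section Veronese.
Variables (K : fieldType) (R : stdgr K) (c : nat).

Fact ver_deg (i j k : int) : i + j = k -> i * c%:Z + j * c%:Z = k * c%:Z.
Proof. by move=> <-; rewrite mulrDl. Qed.

Fact ver_modeg (u : nat) (i j k : int) :
  i + j = k -> i * c%:Z + (j * c%:Z + u%:Z) = k * c%:Z + u%:Z.
Proof. by move=> <-; rewrite mulrDl addrA. Qed.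

(* gone R has the expected type because 0 * c%:Z is convertible to 0.         *)
Definition veralg : gralg K :=
  @GrAlg K (fun j : int => R (j * c%:Z)) (gone R)
    (fun i j k e => gmul R (ver_deg e))
    (fun i j k e => gmul_linear (ver_deg e))
    (fun i j k e e' => gmulC (ver_deg e) (ver_deg e'))
    (fun i j l ij jl m e1 e2 e3 e4 =>
       gmulA (ver_deg e1) (ver_deg e2) (ver_deg e3) (ver_deg e4))
    (fun i e => gmul1 (ver_deg e)).

Lemma stdgr_finite (m : nat) : exists (n : nat) (v : 'I_n -> R m),
  forall x : R m, exists a : 'I_n -> K, x = \sum_t a t *: v t.
Proof.
elim: m => [|m [n [v hv]]].
  exists 1%N, (fun=> gone R) => x; exists (fun=> deg0 x).
  by rewrite big_ord1 deg0K.
have [p [w hw]] := sg_fin R.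
have e : m%:Z + 1 = m.+1%:Z by rewrite -addn1 PoszD.
pose T : finType := ('I_n * 'I_p)%type.
pose z (t : T) : R m.+1 := gmul R e (v t.1) (w t.2).
suff H (x : R m.+1) : exists a : T -> K, x = \sum_t a t *: z t.
  exists #|T|, (fun k => z (enum_val k)) => x; have [a ->] := H x.
  exists (fun k => a (enum_val k)).
  by rewrite (reindex _ (onW_bij _ (enum_val_bij T))).
have [q [x1 [y1 ->]]] := sg_gen e isT isT x.
have /choice[a ha] : forall t, exists a : 'I_n -> K,
  x1 t = \sum_s a s *: v s by move=> t; apply: hv.
have /choice[b hb] : forall t, exists b : 'I_p -> K,
  y1 t = \sum_s b s *: w s by move=> t; apply: hw.
exists (fun s => \sum_t a t s.1 * b t s.2).
under [RHS]eq_bigr => s _ do rewrite scaler_suml.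
rewrite exchange_big /=; apply: eq_bigr => t _.
rewrite ha hb gmul_suml.
under [LHS]eq_bigr => s _ do rewrite gmul_sum.
rewrite pair_big /=; apply: eq_bigr => s _.
by rewrite gmulZ gmulZl scalerA mulrC.
Qed.

Fact ver_neg (c_gt0 : (0 < c)%N) (i : int) :
  i < 0 -> forall x : veralg i, x = 0.
Proof. by move=> i_lt0 x; apply: sg_neg; rewrite pmulr_llt0. Qed.

Fact ver_fin : exists (n : nat) (v : 'I_n -> veralg 1), forall x : veralg 1,
  exists a : 'I_n -> K, x = \sum_t a t *: v t.
Proof. by rewrite /= mul1r; apply: stdgr_finite. Qed.

Fact ver_gen (i j k : int) (e : i + j = k) : 0 <= i -> 0 <= j ->
  forall z : veralg k, exists (n : nat) (x : 'I_n -> veralg i)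
    (y : 'I_n -> veralg j), z = \sum_t gmul veralg e (x t) (y t).
Proof.
by move=> i_ge0 j_ge0 z; apply: (sg_gen (ver_deg e)); rewrite mulr_ge0.
Qed.

Definition veronese (c_gt0 : (0 < c)%N) : stdgr K :=
  @StdGr K veralg (ver_neg c_gt0) (@deg0 K R) (@deg0K K R) (@deg0Z K R)
    ver_fin ver_gen.

(* The Veronese module V_u, with R_(j c + u) in degree j.                     *)
Definition vermod (c_gt0 : (0 < c)%N) (u : nat) : grmod (veronese c_gt0) :=
  @GrMod K (veronese c_gt0) (fun j : int => R (j * c%:Z + u%:Z))
    (fun i j k e => gmul R (ver_modeg u e))
    (fun i j k e => gmul_linear (ver_modeg u e))
    (fun i j k e => gmul_linearl (ver_modeg u e))
    (fun i j l ij jl k e1 e2 e3 e4 =>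
       gmulA (ver_deg e1) (ver_modeg u e2) (ver_modeg u e3) (ver_modeg u e4))
    (fun i e => gmul1 (ver_modeg u e)).

End Veronese.

(* Main.v *)
Require Import Defs.
From HB Require Import structures.
From mathcomp Require Import all_boot all_order all_algebra.
From mathcomp Require Import boolp classical_sets functions constructive_ereal.
From mathcomp Require Import zify.
Set Implicit Arguments.
Unset Strict Implicit.
Unset Printing Implicit Defensive.
Import Order.TTheory GRing.Theory Num.Theory.
Local Open Scope ring_scope.

(** Call a graded module linear if it is generated by finitely many elements
that are independent in degree 0 and if its syzygy module, shifted by one
degree, is again linear; this is a greatest fixed point, and for modules
without components in negative degrees it says that the minimal resolution has
its i-th term generated in degree i.  Everything is read in degrees >= 0, so
that the shift M(s) stands for the truncation of M to degrees >= s.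

The class of linear modules has one decisive closure property: in an exact
sequence 0 -> N -> Z -> Q -> 0, if N and Z are linear then so is Q
(linmod_quotient).  The reason is that the three syzygy modules, suitably
chosen, again form such an exact sequence, so the class of all such Q is stable
under taking syzygies.  If the maximal ideal R(1) is linear, apply this to the
sequence 0 -> N -> R(1)^n -> M(1) -> 0, where N is the shifted syzygy module of
a linear module M: every truncation of M is linear (linmod_shift).

Now let M be linear over R, with free cover R^n -> M and shifted syzygy module
N.  Taking the components of degree jc gives a free cover of the Veronese
module of M over R^(c), whose shifted syzygy module is the Veronese module of
N(c-1).  As N(c-1) is linear over R, the Veronese modules of linear modules are
stable under syzygies, hence linear (linmod_ver).  The module V_u is the
Veronese module of R(u), and the maximal ideal of R^(c), shifted by one degree,
is the Veronese module of R(c), so V_u and K are linear over R^(c).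

It remains to compare linearity with the Betti numbers.  A linear module that
vanishes in negative degrees has a resolution with F_i generated in degree i
(linmod_resolution).  Conversely, let F be a resolution of K and M a module, with
M_0 of finite dimension and no components in negative degrees, such that the
homology of M (x) F in homological degree h vanishes in internal degrees above
h.  Vanishing for h = 0 shows that M is generated in degree 0, and
the long exact sequence of a free cover passes the hypothesis on to the shifted
syzygies; so M is linear (torlin_linmod).  For a Koszul algebra this applies to
K, and the syzygy module of K is the maximal ideal (linmod_maxideal).

Finally Betti numbers are attached to one arbitrary resolution, not to the
linear one.  If F resolves X and G resolves M, both M (x) F and X (x) G compute
the homology of the double complex F (x) G (torvan_balance); using this twice,
with X = K, transports vanishing between any two resolutions of M. *)

(** * Linear maps, transport between components and module structures *)

Section Linear.
Variables (K : fieldType) (U V : lmodType K) (f : U -> V).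
Hypothesis f_lin : linear f.

Definition to_linear : {linear U -> V} :=
  HB.pack f (GRing.isLinear.Build K U V *:%R f f_lin).

Lemma lin0 : f 0 = 0. Proof. exact: (raddf0 to_linear). Qed.
Lemma linD : {morph f : x y / x + y}. Proof. exact: (raddfD to_linear). Qed.
Lemma linB : {morph f : x y / x - y}. Proof. exact: (raddfB to_linear). Qed.
Lemma linZ a : {morph f : x / a *: x}. Proof. exact: (linearZZ to_linear). Qed.
Lemma lin_sum (I : Type) (r : seq I) (P : pred I) (F : I -> U) :
  f (\sum_(i <- r | P i) F i) = \sum_(i <- r | P i) f (F i).
Proof. exact: (raddf_sum to_linear). Qed.

Lemma lin_inj : (forall x, f x = 0 -> x = 0) -> injective f.
Proof.
move=> f0 x y fxy; apply/eqP; rewrite -subr_eq0 (f0 (x - y)) //.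
by rewrite linB fxy subrr.
Qed.
End Linear.

Section Transport.
Variables (K : fieldType) (V : int -> lmodType K).

Definition tr i j (e : i = j) (x : V i) : V j := ecast j (V j) e x.

Lemma tr_id i (e : i = i) (x : V i) : tr e x = x.
Proof. by rewrite (eq_irrelevance e erefl). Qed.

Lemma tr_tr i j k (e : i = j) (e' : j = k) (e'' : i = k) (x : V i) :
  tr e' (tr e x) = tr e'' x.
Proof. by case: k / e' e'' => e''; case: j / e e'' => e''; rewrite !tr_id. Qed.

Lemma tr_linear i j (e : i = j) : linear (tr e).
Proof. by case: j / e. Qed.

Lemma tr_inj i j (e : i = j) : injective (tr e).
Proof. by case: j / e. Qed.

Lemma trK i j (e : i = j) (e' : j = i) : cancel (tr e) (tr e').
Proof. by move=> x; rewrite (tr_tr _ _ (erefl i)). Qed.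
End Transport.
Arguments tr {K V i j}.

Section Action.
Variables (K : fieldType) (A : gralg K) (M : grmod A).

Lemma gact_tr i j j' k (e : i + j = k) (e' : i + j' = k) (d : j = j')
  (a : A i) (m : M j) : gact M e' a (tr d m) = gact M e a m.
Proof. by case: j' / d e' => e'; rewrite (eq_irrelevance e e'). Qed.

Lemma gact_trl i i' j k (e : i + j = k) (e' : i' + j = k) (d : i = i')
  (a : A i) (m : M j) : gact M e' (tr d a) m = gact M e a m.
Proof. by case: i' / d e' => e'; rewrite (eq_irrelevance e e'). Qed.

Lemma tr_gact i j k k' (e : i + j = k) (e' : i + j = k') (d : k = k')
  (a : A i) (m : M j) : tr d (gact M e a m) = gact M e' a m.
Proof. by case: k' / d e' => e'; rewrite (eq_irrelevance e e') tr_id. Qed.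

Lemma gact0 i j k (e : i + j = k) (a : A i) : gact M e a 0 = 0.
Proof. exact: (lin0 (gact_linear e a)). Qed.

Lemma gactl0 i j k (e : i + j = k) (m : M j) : gact M e 0 m = 0.
Proof. exact: (lin0 (gact_linearl e m)). Qed.
End Action.

Section Constructions.
Variables (K : fieldType) (A : gralg K).

Fact greg_linearl i j k (e : i + j = k) (m : A j) :
  linear (fun x : A i => gmul A e x m).
Proof.
have e' : j + i = k by rewrite addrC.
by move=> a x y; rewrite !(gmulC e e') gmul_linear.
Qed.

Definition greg : grmod A :=
  @GrMod K A (fun j => A j) (fun i j k e => gmul A e)
    (fun i j k e => gmul_linear e)
    greg_linearl (fun i j l ij jl k e1 e2 e3 e4 => gmulA e1 e2 e3 e4)
    (fun i e => gmul1 e).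

Fact shift_deg (s i j k : int) : i + j = k -> i + (j + s) = k + s.
Proof. by move=> <-; rewrite addrA. Qed.

Definition gshift (s : int) (M : grmod A) : grmod A :=
  @GrMod K A (fun j => M (j + s))
    (fun i j k e => gact M (shift_deg s e))
    (fun i j k e => gact_linear (shift_deg s e))
    (fun i j k e => gact_linearl (shift_deg s e))
    (fun i j l ij jl k e1 e2 e3 e4 =>
       gactA e1 (shift_deg s e2) (shift_deg s e3) (shift_deg s e4))
    (fun i e => gact1 (shift_deg s e)).

Section Power.
Variables (I : Type) (M : grmod A).

Definition gpow_act i j k (e : i + j = k) (a : A i) (x : I -> M j) : I -> M k :=
  fun t => gact M e a (x t).

Fact gpow_act_linear i j k (e : i + j = k) (a : A i) : linear (gpow_act e a).
Proof. by move=> c x y; apply/funext => t; rewrite /gpow_act gact_linear. Qed.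

Fact gpow_act_linearl i j k (e : i + j = k) (m : I -> M j) :
  linear (fun a : A i => gpow_act e a m).
Proof. by move=> c x y; apply/funext => t; rewrite /gpow_act gact_linearl. Qed.

Fact gpow_actA i j l ij jl k (e1 : i + j = ij) (e2 : ij + l = k)
    (e3 : j + l = jl) (e4 : i + jl = k) (x : A i) (y : A j) (m : I -> M l) :
  gpow_act e2 (gmul A e1 x y) m = gpow_act e4 x (gpow_act e3 y m).
Proof. by apply/funext => t; rewrite /gpow_act (gactA _ _ e3 e4). Qed.

Fact gpow_act1 i (e : 0 + i = i) (m : I -> M i) : gpow_act e (gone A) m = m.
Proof. by apply/funext => t; rewrite /gpow_act gact1. Qed.

Definition gpow : grmod A :=
  @GrMod K A (fun j => I -> M j) gpow_act gpow_act_linear gpow_act_linearl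
    gpow_actA gpow_act1.
End Power.

Lemma tr_gpow (I : Type) (M : grmod A) i j (e : i = j) (x : gpow I M i) t :
  tr e x t = tr e (x t).
Proof. by case: j / e. Qed.

(** Homomorphisms are only constrained in degrees >= 0, because the components
of negative degree of a shifted module stand for nothing: a shift is used as a
truncation. *)
Record ghom (M N : grmod A) := GHom {
  gfun :> forall j, M j -> N j;
  gfun_linear : forall j, 0 <= j -> linear (@gfun j);
  gfun_act : forall i j k (e : i + j = k) (a : A i) (m : M j),
    0 <= i -> 0 <= j -> @gfun k (gact M e a m) = gact N e a (@gfun j m)
}.
End Constructions.
Arguments gfun {K A M N} g j.

Section Hom.
Variables (K : fieldType) (A : gralg K) .
Definition gcomp (M N P : grmod A) (g : ghom N P) (f : ghom M N) : ghom M P.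
Proof.
exists (fun j x => g j (f j x)).
- by move=> j j0 a x y; rewrite (gfun_linear f) // (gfun_linear g).
- by move=> i j k e a m i0 j0; rewrite !gfun_act.
Defined.

Lemma gfun_tr (M N : grmod A) (g : ghom M N) i j (e : i = j) (x : M i) :
  g j (tr e x) = tr e (g i x).
Proof. by case: j / e. Qed.
End Hom.

(** * Kernels *)

Section Kernel.
Variables (K : fieldType) (A : stdgr K) (M N : grmod A) (g : ghom M N).

(** In negative degrees a homomorphism is unconstrained, so there the kernel is
set to 0; this keeps it a submodule, since A has no elements of negative
degree. *)
Definition in_ker j (x : M j) : bool :=
  if 0 <= j then g j x == 0 else x == 0.

Fact in_ker_closed j : submod_closed (@in_ker j).
Proof.
rewrite /in_ker; split=> [|a x y]; rewrite !unfold_in; case: (lerP 0 j) => j0 //.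
- by rewrite (lin0 (gfun_linear g j0)).
- by rewrite gfun_linear // => /eqP-> /eqP->; rewrite scaler0 addr0.
- by move=> /eqP-> /eqP->; rewrite scaler0 addr0.
Qed.

HB.instance Definition _ j :=
  GRing.isSubmodClosed.Build K (M j) (@in_ker j) (in_ker_closed j).

Record kert j := Kert { kval : M j; kvalP : in_ker kval }.
HB.instance Definition _ j := [isSub of kert j for @kval j].
HB.instance Definition _ j := [Choice of kert j by <:].
HB.instance Definition _ j := [SubChoice_isSubZmodule of kert j by <:].
HB.instance Definition _ j := [SubZmodule_isSubLmodule of kert j by <:].

Lemma kval_eq0 j (x : kert j) : 0 <= j -> g j (kval x) = 0.
Proof. by move=> j0; have := kvalP x; rewrite /in_ker j0 => /eqP. Qed.

Fact ker_act_subproof i j k (e : i + j = k) (a : A i) (x : kert j) :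
  in_ker (gact M e a (kval x)).
Proof.
have [i0|i0] := lerP 0 i; last first.
  by rewrite (sg_neg i0 a) gactl0; have := in_ker_closed k; case.
have := kvalP x; rewrite {1}/in_ker; case: lerP => [j0|j0] /eqP x0.
  have k0 : 0 <= k by rewrite -e addr_ge0.
  by rewrite /in_ker k0 gfun_act // x0 gact0.
by rewrite x0 gact0; have := in_ker_closed k; case.
Qed.

Definition ker_act i j k (e : i + j = k) (a : A i) (x : kert j) : kert k :=
  Kert (ker_act_subproof e a x).

Fact ker_act_linear i j k (e : i + j = k) (a : A i) : linear (ker_act e a).
Proof. by move=> c x y; apply: val_inj; rewrite /= gact_linear. Qed.

Fact ker_act_linearl i j k (e : i + j = k) (x : kert j) :
  linear (fun a : A i => ker_act e a x).
Proof. by move=> c a b; apply: val_inj; rewrite /= gact_linearl. Qed.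

Fact ker_actA i j l ij jl k (e1 : i + j = ij) (e2 : ij + l = k)
    (e3 : j + l = jl) (e4 : i + jl = k) (x : A i) (y : A j) (m : kert l) :
  ker_act e2 (gmul A e1 x y) m = ker_act e4 x (ker_act e3 y m).
Proof. by apply: val_inj; rewrite /= (gactA _ _ e3 e4). Qed.

Fact ker_act1 i (e : 0 + i = i) (m : kert i) : ker_act e (gone A) m = m.
Proof. by apply: val_inj; rewrite /= gact1. Qed.

Definition gker : grmod A :=
  @GrMod K A (fun j => kert j) ker_act ker_act_linear ker_act_linearl
    ker_actA ker_act1.

Definition gker_inc (s : int) : ghom (gshift s gker) (gshift s M) :=
  @GHom K A (gshift s gker) (gshift s M) (fun j x => kval x)
    (fun j _ a x y => erefl) (fun i j k e a x _ _ => erefl).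

End Kernel.

(** * Linear modules *)

Section LinearModules.
Variables (K : fieldType) (A : stdgr K).

Definition sexact (N Z Q : int -> lmodType K) (f : forall j, N j -> Z j)
    (q : forall j, Z j -> Q j) : Prop :=
  forall j, 0 <= j -> [/\ injective (f j), forall t, exists z, q j z = t &
    forall z, q j z = 0 <-> exists x, f j x = z].

(** A minimal free cover of a module generated in degree 0: cgen A^n -> M is
bijective in degree 0, so the syzygies start in degree 1, and cker is the syzygy
module moved down by one degree. *)
Record lincover (M : grmod A) := LinCover {
  crk : nat;
  cker : grmod A;
  cgen : ghom (gpow 'I_crk (greg A)) M;
  cinc : ghom cker (gshift 1 (gpow 'I_crk (greg A)));
  cgen_inj : injective (cgen 0);
  cgen_surj : forall m : M 0, exists x, cgen 0 x = m;
  cexact : @sexact (gm cker) (gm (gshift 1 (gpow 'I_crk (greg A))))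
     (gm (gshift 1 M)) cinc (fun j => cgen (j + 1))
}.

(** The greatest class of modules having a cover whose shifted syzygies lie again
in the class.  It is the union of all classes P with this property, so that
coinduction amounts to exhibiting one of them. *)
Definition linmod (M : grmod A) : Prop :=
  exists2 P : grmod A -> Prop, P M &
    forall N, P N -> exists C : lincover N, P (cker C).

Lemma linmod_cover M : linmod M -> exists C : lincover M, linmod (cker C).
Proof. by case=> P PM sP; have [C PC] := sP _ PM; exists C, P. Qed.

Lemma linmodI M (C : lincover M) : linmod (cker C) -> linmod M.
Proof.
move=> linC; exists (fun N => exists D : lincover N, linmod (cker D)).
  by exists C.
by move=> N [D /linmod_cover linD]; exists D.
Qed.

Lemma cgen_onto M (C : lincover M) j (m : M j) :
  0 <= j -> exists x, cgen C j x = m.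
Proof.
rewrite le_eqVlt => /orP[/eqP j0|j0].
  by case: j / j0 m => m; apply: cgen_surj.
have e : (j - 1) + 1 = j by rewrite subrK.
have [|_ /(_ (tr (esym e) m))[z zm] _] := cexact C (j := j - 1); first by lia.
by exists (tr e z); rewrite gfun_tr zm (tr_tr _ _ (erefl j)).
Qed.

Section KernelCover.
Variables (n : nat) (M : grmod A) (g : ghom (gpow 'I_n (greg A)) M).
Hypothesis g_inj : injective (g 0).
Hypothesis g_surj : forall j, 0 <= j -> forall m : M j, exists x, g j x = m.

Fact ker_cover_exact : @sexact (gm (gshift 1 (gker g)))
  (gm (gshift 1 (gpow 'I_n (greg A)))) (gm (gshift 1 M))
  (gker_inc g 1) (fun j => g (j + 1)).
Proof.
move=> j j0; have j1 : 0 <= j + 1 by lia.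
split=> [|t|x]; [exact: val_inj | exact: g_surj |].
split=> [gx|[y <-]]; last exact: (@kval_eq0 _ _ _ _ g (j + 1) y j1).
have xker : in_ker g x by rewrite /in_ker j1 gx.
by exists (Kert xker).
Qed.

Definition ker_cover : lincover M :=
  LinCover g_inj (g_surj (lexx 0)) ker_cover_exact.
End KernelCover.

Definition gbase n (k : 'I_n) : gpow 'I_n (greg A) 0 :=
  fun t => if t == k then gone A else 0.

(** The index j stands for i + 0, so that the lemma applies to whichever of the
two forms occurs. *)
Lemma gmul_gbase n i j (e : i + 0 = j) (e' : i = j) (x : gpow 'I_n (greg A) i) :
  \sum_k gact (gpow 'I_n (greg A)) e (x k) (gbase k) = tr e' x.
Proof.
case: j / e' e => e; apply/funext => t; rewrite fct_sumE (bigD1 t) //=.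
rewrite /gpow_act /gbase eqxx.
have e' : 0 + i = i by rewrite add0r.
rewrite (gmulC e e') gmul1 big1 ?addr0 // => k kt.
by rewrite eq_sym (negPf kt) gmul0.
Qed.

Lemma ghom_gbase n M (g : ghom (gpow 'I_n (greg A)) M) i j (e : i + 0 = j)
    (e' : i = j) (x : gpow 'I_n (greg A) i) : 0 <= i ->
  \sum_k gact M e (x k) (g 0 (gbase k)) = tr e' (g i x).
Proof.
move=> i0; rewrite -gfun_tr -(gmul_gbase e e').
have j0 : 0 <= j by rewrite -e'.
by rewrite (lin_sum (gfun_linear g j0)); apply: eq_bigr => k _; rewrite gfun_act.
Qed.

Lemma ghom_free_ext n M (g h : ghom (gpow 'I_n (greg A)) M) :
  (forall k, g 0 (gbase k) = h 0 (gbase k)) -> forall j, 0 <= j -> g j =1 h j.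
Proof.
move=> gh j j0 x; have e : j + 0 = j by rewrite addr0.
rewrite -[LHS](tr_id (erefl j)) -(ghom_gbase g e) //.
rewrite -[RHS](tr_id (erefl j)) -(ghom_gbase h e) //.
by apply: eq_bigr => k _; rewrite gh.
Qed.

(** Scalar matrices act on powers from the right, as on row vectors. *)
Section MatrixAction.
Variables (m n : nat) (M : grmod A) (C : 'M[K]_(m, n)).
Definition gpmx_fun j (x : gpow 'I_m M j) : gpow 'I_n M j :=
  fun l => \sum_k C k l *: x k.
Fact gpmx_linear j : linear (@gpmx_fun j).
Proof.
move=> a x y; apply/funext => l; rewrite /gpmx_fun /=.
transitivity (a *: (\sum_k C k l *: x k) + \sum_k C k l *: y k) => //.
rewrite scaler_sumr -big_split /=; apply: eq_bigr => k _.
by rewrite scalerA mulrC -scalerA -scalerDr.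
Qed.
Fact gpmx_act i j k (e : i + j = k) (a : A i) (x : gpow 'I_m M j) :
  gpmx_fun (gact _ e a x) = gact (gpow 'I_n M) e a (gpmx_fun x).
Proof.
apply/funext => l; rewrite /gpmx_fun /= /gpow_act /= (lin_sum (gact_linear e a)).
by apply: eq_bigr => t _; rewrite (linZ (gact_linear e a)).
Qed.
Definition gpmx : ghom (gpow 'I_m M) (gpow 'I_n M) :=
  GHom (fun j _ => @gpmx_linear j) (fun i j k e a x _ _ => gpmx_act e a x).
End MatrixAction.

Lemma gpmxM m n p (M : grmod A) (C : 'M[K]_(m, n)) (D : 'M[K]_(n, p)) j
  (x : gpow 'I_m M j) : gpmx M (C *m D) j x = gpmx M D j (gpmx M C j x).
Proof.
apply/funext => l; rewrite /= /gpmx_fun.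
under eq_bigr => k _ do rewrite mxE scaler_suml.
rewrite exchange_big /=; apply: eq_bigr => t _; rewrite scaler_sumr.
by apply: eq_bigr => k _; rewrite scalerA mulrC.
Qed.

Lemma gpmxD m n (M : grmod A) (C D : 'M[K]_(m, n)) j
  (x : gpow 'I_m M j) : gpmx M (C + D) j x = gpmx M C j x + gpmx M D j x.
Proof.
apply/funext => l; rewrite /= /gpmx_fun.
transitivity (\sum_k C k l *: x k + \sum_k D k l *: x k) => //.
rewrite -big_split /=; apply: eq_bigr => k _.
by rewrite mxE scalerDl.
Qed.

Lemma gpmx0 m n (M : grmod A) j (x : gpow 'I_m M j) :
  gpmx M (0 : 'M_(m, n)) j x = 0.
Proof.
by apply/funext => l; rewrite /= /gpmx_fun big1 // => k _; rewrite mxE scale0r.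
Qed.

Lemma gpmx1 n (M : grmod A) j (x : gpow 'I_n M j) : gpmx M 1%:M j x = x.
Proof.
apply/funext => l; rewrite /= /gpmx_fun (bigD1 l) //= mxE eqxx scale1r.
by rewrite big1 ?addr0 // => k kl; rewrite mxE (negPf kl) scale0r.
Qed.
End LinearModules.
Arguments gbase {K A n} k.

(** The rows of C and D form a basis of K^n, whose dual basis is given by the
columns of E and P: D spans the image of the projection 1 - E C along C. *)
Lemma row_free_complement (K : fieldType) m n (C : 'M[K]_(m, n)) : row_free C ->
  exists p (E : 'M_(n, m)) (D : 'M_(p, n)) (P : 'M_(n, p)),
    [/\ C *m E = 1%:M, C *m P = 0, D *m P = 1%:M & E *m C + P *m D = 1%:M].
Proof.
move=> Cfree; pose B := 1%:M - pinvmx C *m C.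
have CE := mulmxVp Cfree.
have CB : C *m B = 0 by rewrite mulmxBr mulmxA CE mulmx1 mul1mx subrr.
have BB : B *m B = B by rewrite {1}/B mulmxBl mul1mx -mulmxA CB mulmx0 subr0.
exists (\rank B), (pinvmx C), (row_base B), (col_base B).
have /row_fullP := col_base_full B; have := row_base_free B.
move: (mulmx_base B).
move: (\rank B) (col_base B) (row_base B) => r P D PD Dfree [V VP].
split=> //; last by rewrite PD addrC subrK.
  by apply: (row_free_inj Dfree); rewrite /= -mulmxA PD mul0mx.
apply: (row_free_inj Dfree); rewrite /= mul1mx -mulmxA PD.
by rewrite -[LHS]mul1mx -VP -mulmxA (mulmxA P) PD BB -PD mulmxA VP mul1mx.
Qed.

(** * Quotients of linear modules by linear submodules *)

Section Quotient.
Variables (K : fieldType) (A : stdgr K) (N Z Q : grmod A).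
Variables (f : ghom N Z) (q : ghom Z Q) (exfq : sexact f q).
Variables (CN : lincover N) (CZ : lincover Z).

Let m := crk CN.
Let n := crk CZ.

(** A free module is determined in degree 0, so f lifts to a scalar matrix
between the covers. *)
Lemma cover_lift : exists C : 'M[K]_(m, n),
  forall j, 0 <= j -> forall x, f j (cgen CN j x) = cgen CZ j (gpmx _ C j x).
Proof.
have /choice[y yP] k : exists y, cgen CZ 0 y = f 0 (cgen CN 0 (gbase k)).
  exact: cgen_surj.
exists (\matrix_(k, l) deg0 (y k l)) => j j0 x.
pose C := \matrix_(k < m, l < n) deg0 (y k l).
apply: (@ghom_free_ext _ _ _ _ (gcomp f (cgen CN))
  (gcomp (cgen CZ) (gpmx (greg A) C))) => // k.
rewrite /= -yP; congr (cgen CZ 0 _); apply/funext => l.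
rewrite /gpmx_fun /gbase (bigD1 k) //= eqxx mxE deg0K big1 ?addr0 // => t tk.
by rewrite (negPf tk) scaler0.
Qed.

Lemma cover_lift_free (C : 'M[K]_(m, n)) :
    (forall x, f 0 (cgen CN 0 x) = cgen CZ 0 (gpmx _ C 0 x)) ->
  row_free C.
Proof.
move=> CP; apply: inj_row_free => v vC.
pose x : gpow 'I_m (greg A) 0 := fun k => v 0 k *: gone A.
have xC : gpmx (greg A) C 0 x = 0.
  apply/funext => l; rewrite /= /gpmx_fun.
  under eq_bigr => k _ do rewrite /x scalerA mulrC.
  rewrite -scaler_suml.
  transitivity ((v *m C) 0 l *: gone A); first by rewrite mxE.
  by rewrite vC mxE scale0r.
have l0 : (0 : int) <= 0 by [].
have := CP x; rewrite xC (lin0 (gfun_linear _ l0)) => fgx.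
have [finj _ _] := exfq l0.
have gx : cgen CN 0 x = 0.
  by apply: finj; rewrite fgx (lin0 (gfun_linear f l0)).
have x0 : x = 0.
  by apply: (@cgen_inj _ _ _ CN); rewrite gx (lin0 (gfun_linear _ l0)).
apply/rowP => k; rewrite mxE -[LHS](@deg0Z K A).
have -> : v 0 k *: gone A = 0 by have := congr1 (fun h => h k) x0.
by rewrite (lin0 (@deg0_linear K A)).
Qed.

(** The rows of D complete those of C to a basis of the generators of Z, hence
they index minimal generators of Q.  The syzygies then form an exact sequence by
a chase in the diagram of the three covers, in which A^n is split by E C + P D.
*)
Lemma cover_quotient : exists (CQ : lincover Q) (f' : ghom (cker CN) (cker CZ))
  (q' : ghom (cker CZ) (cker CQ)), sexact f' q'.
Proof.
have [C CP] := cover_lift.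
have [p [E [D [P [CE CP0 DP EC]]]]] :=
  row_free_complement (cover_lift_free (CP 0 isT)).
have fq0 j : 0 <= j -> forall x, q j (f j x) = 0.
  by move=> j0 x; have [_ _ ex] := exfq j0; apply/ex; exists x.
have qgEC j (j0 : 0 <= j) (x : gpow 'I_n (greg A) j) :
    q j (cgen CZ j (gpmx _ (E *m C) j x)) = 0.
  by rewrite gpmxM -CP // fq0.
have qgPD j (j0 : 0 <= j) (x : gpow 'I_n (greg A) j) :
    q j (cgen CZ j (gpmx _ (P *m D) j x)) = q j (cgen CZ j x).
  rewrite -[x in RHS]gpmx1 -EC gpmxD.
  by rewrite (linD (gfun_linear _ j0)) (linD (gfun_linear q j0)) qgEC // add0r.
have q0 : 0 <= 0 :> int by [].
have [_ qsurj0 qex0] := exfq q0.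
pose g := gcomp q (gcomp (cgen CZ) (gpmx (greg A) D)).
have gE j (x : gpow 'I_p (greg A) j) :
  g j x = q j (cgen CZ j (gpmx _ D j x)) by [].
have ginj : injective (g 0).
  apply: lin_inj; first exact: gfun_linear.
  move=> x; rewrite gE => /qex0[y fy].
  have [w wy] := @cgen_surj _ _ _ CN y.
  have xDC : gpmx (greg A) D 0 x = gpmx _ C 0 w.
    by apply: (@cgen_inj _ _ _ CZ); rewrite -fy -wy CP.
  by rewrite -(gpmx1 x) -DP gpmxM xDC -gpmxM CP0 gpmx0.
have gsurj j : 0 <= j -> forall t, exists x, g j x = t.
  move=> j0 t; have [_ qsurj _] := exfq j0; have [z zt] := qsurj t.
  have [w wz] := cgen_onto CZ z j0.
  by exists (gpmx _ P j w); rewrite gE -gpmxM qgPD // wz.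
pose Q' := gshift 1 (gker g).
have incP j (x : Q' j) : 0 <= j -> g (j + 1) (kval x) = 0.
  by move=> j0; apply: kval_eq0; lia.
pose CQ := ker_cover ginj gsurj.
(* The syzygies of Z embed in the free module, so f' is forced by C. *)
pose f' j (x : cker CN j) : cker CZ j :=
  xget 0 [set z | cinc CZ j z = gpmx _ C (j + 1) (cinc CN j x)].
have f'E j (x : cker CN j) : 0 <= j ->
    cinc CZ j (f' j x) = gpmx _ C (j + 1) (cinc CN j x).
  move=> j0; rewrite /f'; case: xgetP => [z _ //|no].
  have [_ _ ex2] := cexact CZ j0; have [_ _ ex1] := cexact CN j0.
  have : cgen CZ (j + 1) (gpmx _ C (j + 1) (cinc CN j x)) = 0.
    rewrite -CP; last by lia.
    have -> : cgen CN (j + 1) (cinc CN j x) = 0 by apply/ex1; exists x.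
    by rewrite (lin0 (gfun_linear f _)) //; lia.
  by move/ex2 => [z zE]; case: (no z).
have f'lin j : 0 <= j -> linear (f' j).
  move=> j0 a x y; have [inj2 _ _] := cexact CZ j0; apply: inj2.
  rewrite gfun_linear // !f'E // gfun_linear //.
  exact: gpmx_linear.
have f'act i j k (e : i + j = k) (a : A i) (x : cker CN j) : 0 <= i -> 0 <= j ->
    f' k (gact _ e a x) = gact _ e a (f' j x).
  move=> i0 j0; have k0 : 0 <= k by lia.
  have [inj2 _ _] := cexact CZ k0; apply: inj2.
  by rewrite gfun_act // !f'E // gfun_act // [LHS]gpmx_act.
(* The default value 0 is only met in degrees where q' is unconstrained. *)
pose q' j (z : cker CZ j) : Q' j := insubd 0 (gpmx _ P (j + 1) (cinc CZ j z)).
have q'E j (z : cker CZ j) : 0 <= j ->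
    kval (q' j z) = gpmx _ P (j + 1) (cinc CZ j z).
  move=> j0; rewrite [LHS]insubdK //.
  have j1 : 0 <= j + 1 by lia.
  rewrite unfold_in /in_ker j1 gE -gpmxM qgPD //.
  have [_ _ ex2] := cexact CZ j0.
  have -> : cgen CZ (j + 1) (cinc CZ j z) = 0 by apply/ex2; exists z.
  by rewrite (lin0 (gfun_linear q j1)).
have q'lin j : 0 <= j -> linear (q' j).
  move=> j0 a x y; apply: val_inj; rewrite /= !q'E // gfun_linear //.
  exact: (@gpmx_linear _ _ _ _ (greg A) P (j + 1) a).
have q'act i j k (e : i + j = k) (a : A i) (x : cker CZ j) : 0 <= i -> 0 <= j ->
    q' k (gact _ e a x) = gact _ e a (q' j x).
  move=> i0 j0; have k0 : 0 <= k by lia.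
  apply: val_inj; rewrite /= !q'E // gfun_act //.
  exact: (@gpmx_act _ _ _ _ (greg A) P _ _ _ (shift_deg 1 e) a).
exists CQ, (GHom f'lin f'act), (GHom q'lin q'act) => j j0 /=.
have j1 : 0 <= j + 1 by lia.
have [inj1 surj1 ex1] := cexact CN j0; have [inj2 surj2 ex2] := cexact CZ j0.
have f2lin := gfun_linear (cinc CZ) j0.
split=> [|x|z].
- apply: lin_inj; first exact: f'lin.
  move=> x x0; apply: inj1; rewrite (lin0 (gfun_linear _ j0)).
  rewrite -[LHS](gpmx1 (M := greg A)) -CE gpmxM -f'E // x0 (lin0 f2lin).
  exact: (lin0 (@gpmx_linear _ _ _ _ _ _ _)).
- have := incP _ x j0; rewrite gE.
  have [_ _ exj] := exfq j1 => /exj[y fy].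
  have [w wy] := cgen_onto CN y j1.
  have : cgen CZ (j + 1) (gpmx _ D (j + 1) (kval x) - gpmx _ C (j + 1) w) = 0.
    by rewrite (linB (gfun_linear _ j1)) -CP // wy fy subrr.
  move/ex2 => [z zE]; exists z; apply: val_inj; rewrite /= q'E // zE.
  have PB u v : gpmx (greg A) P (j + 1) (u - v) =
      gpmx _ P (j + 1) u - gpmx _ P (j + 1) v.
    exact: (linB (@gpmx_linear _ _ _ _ (greg A) P (j + 1))).
  by rewrite [LHS]PB -!gpmxM CP0 DP gpmx0 subr0 gpmx1.
- split=> [qz|[x <-]]; last first.
    apply: val_inj; rewrite /= q'E // f'E // -gpmxM CP0.
    by rewrite [LHS]gpmx0.
  have zP : gpmx _ P (j + 1) (cinc CZ j z) = 0 by rewrite -q'E // qz.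
  have zE : cinc CZ j z = gpmx _ C (j + 1) (gpmx _ E (j + 1) (cinc CZ j z)).
    rewrite -[LHS](gpmx1 (M := greg A)) -EC gpmxD !gpmxM zP.
    by rewrite [X in _ + X](lin0 (@gpmx_linear _ _ _ _ _ _ _)) addr0.
  have gz : cgen CZ (j + 1) (cinc CZ j z) = 0 by apply/ex2; exists z.
  have [injf _ _] := exfq j1.
  have /ex1[x xE] : cgen CN (j + 1) (gpmx _ E (j + 1) (cinc CZ j z)) = 0.
    by apply: injf; rewrite CP // -zE gz (lin0 (gfun_linear f j1)).
  by exists x; apply: inj2; rewrite f'E // xE -zE.
Qed.
End Quotient.

Lemma linmod_quotient (K : fieldType) (A : stdgr K) (N Z Q : grmod A)
    (f : ghom N Z) (q : ghom Z Q) :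
  sexact f q -> linmod N -> linmod Z -> linmod Q.
Proof.
move=> exfq linN linZ.
exists (fun X => exists N Z (f : ghom N Z) (q : ghom Z X),
  [/\ linmod N, linmod Z & sexact f q]); first by exists N, Z, f, q.
move=> X [N1 [Z1 [f1 [q1 []]]]] /linmod_cover[CN linCN] /linmod_cover[CZ linCZ].
move=> /(cover_quotient)/(_ CN CZ)[CX [f' [q' ex']]].
by exists CX, (cker CN), (cker CZ), f', q'.
Qed.

(** * Further closure properties *)

Section Closure.
Variables (K : fieldType) (A : stdgr K).

Fact ghom0_linear (V W : lmodType K) : linear (fun _ : V => 0 : W).
Proof. by move=> a x y; rewrite scaler0 addr0. Qed.

Definition ghom0 (M N : grmod A) : ghom M N :=
  @GHom K A M N (fun j x => 0) (fun j _ => @ghom0_linear (M j) (N j))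
    (fun i j k e a x _ _ => esym (gact0 N e a)).

Lemma linmod_vanishing (M : grmod A) :
  (forall j, 0 <= j -> forall x : M j, x = 0) -> linmod M.
Proof.
move=> M0.
exists (fun N : grmod A => forall j, 0 <= j -> forall x : N j, x = 0) => // N N0.
(* The empty cover, with N serving as its own syzygy module. *)
have pow0 j (x y : gpow 'I_0 (greg A) j) : x = y by apply/funext; case.
have ex : @sexact _ (gm N) (gm (gshift 1 (gpow 'I_0 (greg A)))) (gm (gshift 1 N))
    (ghom0 _ _) (fun j => ghom0 (gpow 'I_0 (greg A)) N (j + 1)).
  move=> j j0; have j1 : 0 <= j + 1 by lia.
  split=> [x y _|t|z]; first by rewrite (N0 _ j0 x) (N0 _ j0 y).
    by exists 0; rewrite [RHS](N0 _ j1).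
  by split=> // _; exists 0; apply: pow0.
have inj : injective (ghom0 (gpow 'I_0 (greg A)) N 0) by move=> x y _; apply: pow0.
have surj (m : N 0) : exists x, ghom0 (gpow 'I_0 (greg A)) N 0 x = m.
  by exists 0; rewrite [RHS](N0 0).
by exists (LinCover inj surj ex).
Qed.

Lemma linmod_iso (M N : grmod A) (h : ghom M N) :
    (forall j, 0 <= j -> bijective (h j)) -> linmod M -> linmod N.
Proof.
move=> hbij /linmod_cover[C linC].
have ex : @sexact _ (gm (cker C)) (gm (gshift 1 (gpow 'I_(crk C) (greg A))))
    (gm (gshift 1 N)) (cinc C) (fun j => gcomp h (cgen C) (j + 1)).
  move=> j j0; have j1 : 0 <= j + 1 by lia.
  have [inj surj exC] := cexact C j0; have hinj := bij_inj (hbij _ j1).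
  have [h' _ hK] := hbij _ j1.
  split=> // [t|z /=].
    by have [z zE] := surj (h' t); exists z; rewrite /= zE hK.
  rewrite -exC -[0](lin0 (gfun_linear h j1)).
  by split=> [/hinj->|->].
have l0 : 0 <= 0 :> int by [].
have inj : injective (gcomp h (cgen C) 0).
  by apply: inj_comp (bij_inj (hbij _ l0)) (@cgen_inj _ _ _ C).
have surj (m : N 0) : exists x, gcomp h (cgen C) 0 x = m.
  have [h' _ hK] := hbij 0 l0; have [x xE] := cgen_surj C (h' m).
  by exists x; rewrite /= xE hK.
exact: (linmodI (C := LinCover inj surj ex)).
Qed.

Lemma linmod_greg : linmod (greg A).
Proof.
pose g : ghom (gpow 'I_1 (greg A)) (greg A) :=
  @GHom K A (gpow 'I_1 (greg A)) (greg A) (fun j x => x ord0)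
    (fun j _ a x y => erefl) (fun i j k e a x _ _ => erefl).
have ginj j : injective (g j).
  by move=> x y xy; apply/funext => t; rewrite (ord1 t).
have gsurj j (m : A j) : exists x, g j x = m by exists (fun=> m).
have pow0 j (x y : gpow 'I_0 (greg A) j) : x = y by apply/funext; case.
have ex : @sexact _ (gm (gpow 'I_0 (greg A))) (gm (gshift 1 (gpow 'I_1 (greg A))))
    (gm (gshift 1 (greg A))) (ghom0 _ _) (fun j => g (j + 1)).
  move=> j j0; split=> [x y _|t|z]; [exact: pow0|exact: gsurj|].
  split=> [gz|[_ <-] //]; exists 0.
  by apply: ginj; rewrite gz.
apply: (linmodI (C := LinCover (ginj 0) (gsurj 0) ex)).
by apply: linmod_vanishing => j _ x; apply: pow0.
Qed.

Section Power.
Variables (m : nat) (M : grmod A) (C : lincover M).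
Let T : finType := ('I_m * 'I_(crk C))%type.
Let F := gpow 'I_#|T| (greg A).

Let slice j (x : F j) (t : 'I_m) : gpow 'I_(crk C) (greg A) j :=
  fun i => x (enum_rank (t, i)).
Let glue j (y : gpow 'I_m (gpow 'I_(crk C) (greg A)) j) : F j :=
  fun r => y (enum_val r).1 (enum_val r).2.

Let sliceK j (x : F j) : glue (slice x) = x.
Proof.
by apply/funext => r; rewrite /glue /slice -surjective_pairing enum_valK.
Qed.
Let glueK j y : slice (@glue j y) = y.
Proof.
by apply/funext => t; apply/funext => i; rewrite /glue /slice enum_rankK.
Qed.

Lemma lincover_pow : exists D : lincover (gpow 'I_m M),
  cker D = gpow 'I_m (cker C).
Proof.
have glin j : 0 <= j -> linear (fun (x : F j) t => cgen C j (slice x t)).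
  move=> j0 a x y; apply/funext => t.
  exact: (gfun_linear (cgen C) j0 a (slice x t) (slice y t)).
have gact_ i j k (e : i + j = k) (a : A i) (x : F j) : 0 <= i -> 0 <= j ->
    (fun t => cgen C k (slice (gact F e a x) t)) =
    gact (gpow 'I_m M) e a (fun t => cgen C j (slice x t)).
  by move=> i0 j0; apply/funext => t; rewrite [RHS]/= /gpow_act -gfun_act.
pose g : ghom F (gpow 'I_m M) := @GHom K A F (gpow 'I_m M) _ glin gact_.
have flin j : 0 <= j -> linear (fun y : gpow 'I_m (cker C) j =>
    glue (fun t => cinc C j (y t)) : gshift 1 F j).
  by move=> j0 a x y; apply/funext => r; rewrite /glue /= gfun_linear.
have f_act i j k (e : i + j = k) (a : A i) (y : gpow 'I_m (cker C) j) :
    0 <= i -> 0 <= j -> 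
    (glue (fun t => cinc C k ((gact _ e a y) t)) : gshift 1 F k) =
    gact (gshift 1 F) e a (glue (fun t => cinc C j (y t)) : gshift 1 F j).
  by move=> i0 j0; apply/funext => r; rewrite /glue /= /gpow_act gfun_act.
pose f : ghom (gpow 'I_m (cker C)) (gshift 1 F) :=
  @GHom K A (gpow 'I_m (cker C)) (gshift 1 F) _ flin f_act.
have l0 : 0 <= 0 :> int by [].
have ginj : injective (g 0).
  move=> x y xy; rewrite -(sliceK x) -(sliceK y); congr (glue _).
  apply/funext => t; apply: (@cgen_inj _ _ _ C).
  exact: (congr1 (fun h => h t) xy).
have gsurj j (y : gpow 'I_m M j) : 0 <= j -> exists x, g j x = y.
  move=> j0; have /choice[x xE] t : exists x, cgen C j x = y t.
    exact: cgen_onto.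
  by exists (glue x); apply/funext => t; rewrite /= glueK.
have ex : @sexact _ (gm (gpow 'I_m (cker C))) (gm (gshift 1 F))
    (gm (gshift 1 (gpow 'I_m M))) f (fun j => g (j + 1)).
  move=> j j0; have j1 : 0 <= j + 1 by lia.
  have [inj surj exC] := cexact C j0.
  split=> [x y xy|t|z]; last split=> [gz|[y <-]].
  - apply/funext => t; apply: inj.
    have := congr1 (fun h => slice h t) xy.
    by rewrite /= !glueK.
  - exact: gsurj.
  - have /choice[y yE] t : exists y, cinc C j y = slice z t.
      by apply/exC; apply: (congr1 (fun h => h t) gz).
    exists y; rewrite -[RHS]sliceK; congr (glue _).
    by apply/funext => t; rewrite yE.
  - apply/funext => t; rewrite /= glueK; apply/exC.
    by exists (y t).
by exists (LinCover ginj (fun t => gsurj 0 t l0) ex).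
Qed.
End Power.

(** The syzygies of M^m are the m-th power of those of M. *)
Lemma linmod_pow m (M : grmod A) : linmod M -> linmod (gpow 'I_m M).
Proof.
move=> linM; exists (fun X => exists2 N, linmod N & X = gpow 'I_m N).
  by exists M.
move=> _ [N /linmod_cover[C linC] ->].
by have [D DE] := lincover_pow m C; exists D, (cker C).
Qed.

(** In degrees >= 0, M(s) is the truncation of M.  The inductive step is the
sequence 0 -> N -> A(1)^n -> M(s)(1) -> 0 given by a cover of M(s), with N its
shifted syzygies: the first two terms are linear. *)
Lemma linmod_shift (M : grmod A) (s : nat) :
  linmod (gshift 1 (greg A)) -> linmod M -> linmod (gshift s%:Z M).
Proof.
move=> linA1 linM; elim: s => [|s IHs].
  have e j : j = j + 0%N%:Z by rewrite addr0.
  have hact i j k (d : i + j = k) (a : A i) (x : M j) : 0 <= i -> 0 <= j ->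
      tr (e k) (gact M d a x) =
      gact (gshift 0%N%:Z M) d a (tr (e j) x : gshift 0%N%:Z M j).
    move=> _ _; rewrite [RHS](gact_tr (etrans d (e k))).
    exact: tr_gact.
  pose h := @GHom K A M (gshift 0%N%:Z M) (fun j => tr (e j))
     (fun j _ => @tr_linear K (gm M) _ _ (e j)) hact.
  apply: (linmod_iso (h := h)) linM => j _.
  by exists (tr (esym (e j))); apply: trK.
have [C linC] := linmod_cover IHs.
have e j : (j + 1) + s%:Z = j + s.+1%:Z by lia.
pose n := crk C; pose Z := gpow 'I_n (gshift 1 (greg A)).
pose f := @GHom K A (cker C) Z (cinc C) (@gfun_linear _ _ _ _ (cinc C))
   (@gfun_act _ _ _ _ (cinc C)).
have qlin j : 0 <= j -> linear (fun x : Z j => tr (e j) (cgen C (j + 1) x : M _)).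
  move=> j0 a x y; rewrite -tr_linear; congr (tr _ _).
  have j1 : 0 <= j + 1 by lia.
  exact: (gfun_linear (cgen C) j1 a).
have qact i j k (d : i + j = k) (a : A i) (x : Z j) : 0 <= i -> 0 <= j ->
    tr (e k) (cgen C (k + 1) (gact Z d a x) : M _) =
    gact (gshift s.+1%:Z M) d a (tr (e j) (cgen C (j + 1) x : M _)).
  move=> i0 j0; have j1 : 0 <= j + 1 by lia.
  rewrite [cgen C _ _](gfun_act (cgen C) (shift_deg 1 d) a x i0 j1).
  have d' : i + (j + 1 + s%:Z) = k + s.+1%:Z by lia.
  by rewrite [RHS](gact_tr d') [LHS](tr_gact _ d').
pose q := @GHom K A Z (gshift s.+1%:Z M) _ qlin qact.
apply: (linmod_quotient (f := f) (q := q)) => //; last exact: linmod_pow.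
move=> j j0; have [inj surj exC] := cexact C j0; split=> // [t|z].
  have [z zE] := surj (tr (esym (e j)) t : M _); exists z.
  by rewrite /= zE trK.
rewrite -exC; split=> [qz|gz]; last first.
  by rewrite /= gz (lin0 (@tr_linear K (gm M) _ _ (e j))).
apply: (@tr_inj K (gm M) _ _ (e j)).
by rewrite (lin0 (@tr_linear K (gm M) _ _ (e j))).
Qed.
End Closure.

(** * Veronese modules *)

Section Veronese.
Variables (K : fieldType) (R : stdgr K) (c : nat) (c_gt0 : (0 < c)%N).
Let A := veronese R c_gt0.

Definition gver (M : grmod R) : grmod A :=
  @GrMod K A (fun j : int => M (j * c%:Z))
    (fun i j k e => gact M (ver_deg c e))
    (fun i j k e => gact_linear (ver_deg c e))
    (fun i j k e => gact_linearl (ver_deg c e))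
    (fun i j l ij jl k e1 e2 e3 e4 =>
       gactA (ver_deg c e1) (ver_deg c e2) (ver_deg c e3) (ver_deg c e4))
    (fun i e => gact1 (ver_deg c e)).

Section Cover.
Variables (M : grmod R) (C : lincover M).
Let n := crk C.
Let N := gver (gshift c.-1%:Z (cker C)).
Let F := gpow 'I_n (greg A).
Let d (j : int) : j * c%:Z + c.-1%:Z + 1 = (j + 1) * c%:Z.
Proof. by move: c_gt0; rewrite mulrDl; lia. Qed.

(** The component of degree jc of the cover of M, for all j, is a cover over the
Veronese subalgebra.  Its syzygies of degree j+1 are those of M of degree
(j+1)c, that is the element of degree jc + (c-1) of the shifted syzygies. *)
Lemma lincover_ver : exists D : lincover (gver M), cker D = N.
Proof.
have jc j : 0 <= j -> 0 <= j * c%:Z by move=> j0; rewrite mulr_ge0.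
have glin j : 0 <= j -> linear (fun x : F j => cgen C (j * c%:Z) x : gver M j).
  by move=> /jc j0; apply: (gfun_linear (cgen C) j0).
have gact_ i j k (e : i + j = k) (a : A i) (x : F j) : 0 <= i -> 0 <= j ->
    cgen C (k * c%:Z) (gact F e a x) =
    gact (gver M) e a (cgen C (j * c%:Z) x).
  by move=> /jc i0 /jc j0; apply: (gfun_act (cgen C) (ver_deg c e)).
pose g := @GHom K A F (gver M) _ glin gact_.
have tlin j := @tr_linear K (gm (greg R)) _ _ (d j).
have jcc j : 0 <= j -> 0 <= j * c%:Z + c.-1%:Z by move=> /jc; lia.
have flin j : 0 <= j -> linear (fun (y : N j) => 
    (fun t => tr (d j) (cinc C (j * c%:Z + c.-1%:Z) y t) : A (j + 1)) : gshift 1 F j).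
  move=> /jcc j0 a x y; apply/funext => t; rewrite gfun_linear //.
  by rewrite [LHS](tlin j).
have f_act i j k (e : i + j = k) (a : A i) (y : N j) : 0 <= i -> 0 <= j ->
    (fun t => tr (d k) (cinc C (k * c%:Z + c.-1%:Z) (gact N e a y) t)
        : A (k + 1)) =
    gact (gshift 1 F) e a
      ((fun t => tr (d j) (cinc C (j * c%:Z + c.-1%:Z) y t)) : gshift 1 F j).
  move=> /jc i0 /jcc j0; apply/funext => t.
  rewrite [cinc C _ _](gfun_act (cinc C)) //.
  have e' : i * c%:Z + (j * c%:Z + c.-1%:Z + 1) = (k + 1) * c%:Z.
    by rewrite d -mulrDl addrA e.
  rewrite [LHS](@tr_gact K R (greg R) _ _ _ _ _ e').
  by rewrite [RHS](@gact_tr K R (greg R) _ _ _ _ e').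
pose f : ghom N (gshift 1 F) := @GHom K A N (gshift 1 F) _ flin f_act.
have ex : @sexact _ (gm N) (gm (gshift 1 F))
    (gm (gshift 1 (gver M))) f (fun j => g (j + 1)).
  move=> j j0; have j1 : 0 <= (j + 1) * c%:Z by apply: jc; lia.
  have [inj surj exC] := cexact C (jcc _ j0).
  split=> [x y xy|t|z]; last split=> [gz|[y <-]].
  - apply: inj; apply/funext => t.
    apply: (@tr_inj K (gm (greg R)) _ _ (d j)).
    exact: (congr1 (fun h => h t) xy).
  - exact: cgen_onto.
  - pose z' : gpow 'I_n (greg R) (j * c%:Z + c.-1%:Z + 1) :=
      fun t => tr (esym (d j)) (z t : R _).
    have /exC[y yE] : cgen C (j * c%:Z + c.-1%:Z + 1) z' = 0.
      have -> : z' = tr (esym (d j)) (z : gpow 'I_n (greg R) ((j + 1) * c%:Z)).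
        apply/funext => t; rewrite /z'; move: (esym (d j)).
        by case: _ /.
      rewrite gfun_tr [X in tr _ X](gz : cgen C ((j + 1) * c%:Z) z = 0).
      exact: (lin0 (@tr_linear K (gm M) _ _ _)).
    by exists y; apply/funext => t; rewrite /= yE trK.
  - have : cgen C (j * c%:Z + c.-1%:Z + 1) (cinc C (j * c%:Z + c.-1%:Z) y) = 0.
      by apply/exC; exists y.
    rewrite /=.
    have -> : (fun t => tr (d j) (cinc C (j * c%:Z + c.-1%:Z) y t)) =
       tr (d j) (cinc C (j * c%:Z + c.-1%:Z) y
         : gpow 'I_n (greg R) (j * c%:Z + c.-1%:Z + 1)).
      by apply/funext => t; case: _ / (d j).
    move=> gy; rewrite gfun_tr gy.
    exact: (lin0 (@tr_linear K (gm M) _ _ _)).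
have ginj : injective (g 0) := cgen_inj (l := C).
have gsurj : forall m, exists x, g 0 x = m := cgen_surj C.
by exists (LinCover ginj gsurj ex).
Qed.
End Cover.

(** The truncation N(c-1) of the shifted syzygies N of a linear module is again
linear, so the class of Veronese modules of linear modules is closed under
syzygies. *)
Lemma linmod_ver (M : grmod R) :
  linmod (gshift 1 (greg R)) -> linmod M -> linmod (gver M).
Proof.
move=> linR1 linM; exists (fun X => exists2 N, linmod N & X = gver N).
  by exists M.
move=> _ [N /linmod_cover[C linC] ->]; have [D DE] := lincover_ver C; exists D.
by rewrite DE; exists (gshift c.-1%:Z (cker C)) => //; apply: linmod_shift.
Qed.
End Veronese.

(** * From linear modules to linear resolutions *)

Section LinearResolution.
Variables (K : fieldType) (A : stdgr K) (M : grmod A).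
Hypothesis linM : linmod M.
Hypothesis M_neg : forall j, j < 0 -> forall x : M j, x = 0.

(* Successive shifted syzygies, with a chosen cover at each stage.
   The differentials are the inclusions of syzygies composed with the covers. *)
Let linsyz := {N : grmod A | linmod N}.
Let cov_ex (S : linsyz) := cid (linmod_cover (svalP S)).
Let cov (S : linsyz) : lincover (sval S) := sval (cov_ex S).
Let next (S : linsyz) : linsyz := exist _ (cker (cov S)) (svalP (cov_ex S)).
Let syz i : linsyz := iter i next (exist _ M linM).

Let C i := cov (syz i).
Let r i := crk (C i).
Let g i : ghom (gpow 'I_(r i) (greg A)) (sval (syz i)) := cgen (C i).
Let f i : ghom (sval (syz i.+1)) (gshift 1 (gpow 'I_(r i) (greg A))) := cinc (C i).

Let deg i (k : 'I_(r i)) : int := i%:Z.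
Let diff_deg i : 0 + 1 = i.+1%:Z - i%:Z :> int.
Proof. by lia. Qed.
Let diff i (k : 'I_(r i.+1)) (l : 'I_(r i)) : A (deg k - deg l) :=
  tr (V := A) (diff_deg i) (f i 0 (g i.+1 0 (gbase k)) l).

Let shifted i (j : int) : j - i.+1%:Z + 1 = j - i%:Z.
Proof. by lia. Qed.

Let diffE i j (x : grfree A (@deg i.+1) j) l : 0 <= j - i.+1%:Z ->
  frmap (@diff i) x l =
  tr (V := A) (shifted i j) (f i (j - i.+1%:Z) (g i.+1 (j - i.+1%:Z) x) l).
Proof.
set t := j - i.+1%:Z => t0; have t1 : t + 0 = t by rewrite addr0.
rewrite -[g i.+1 t x](tr_id (erefl t)) -(ghom_gbase (g i.+1) t1) //.
rewrite (lin_sum (gfun_linear (f i) t0)) fct_sumE.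
rewrite (lin_sum (@tr_linear K (gm (greg A)) _ _ _)); apply: eq_bigr => k _.
rewrite gfun_act //=.
have e : t + (0 + 1) = j - i%:Z by rewrite /t; lia.
rewrite [LHS](@gact_tr K A (greg A) _ _ _ _ e).
by rewrite [RHS](@tr_gact K A (greg A) _ _ _ _ _ e).
Qed.

Let neg0 i j (x : grfree A (@deg i) j) : j - i%:Z < 0 -> x = fun=> 0.
Proof. by move=> j0; apply: functional_extensionality_dep => k; apply: sg_neg. Qed.

Let frmap0 i j l : frmap (@diff i) ((fun=> 0) : grfree A (@deg i.+1) j) l = 0.
Proof. by rewrite /frmap big1 // => k _; rewrite gmul0l. Qed.

Let aug_deg (j : int) : j - 0%N%:Z = j.
Proof. by rewrite subr0. Qed.

Let augE j (x : grfree A (@deg 0%N) j) : 0 <= j ->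
  fraug (fun k => g 0%N 0 (gbase k) : M (deg k)) x =
  tr (aug_deg j) (g 0%N (j - 0%N%:Z) x).
Proof.
move=> j0; have e : j - 0%N%:Z + 0 = j by rewrite addr0 aug_deg.
rewrite -(ghom_gbase (g 0%N) e) ?aug_deg //; apply: eq_bigr => k _.
congr (gact _ _ _ _); exact: eq_irrelevance.
Qed.

Let ginj i t : t = 0 -> injective (g i t).
Proof. by move=> ->; apply: (@cgen_inj _ _ _ (C i)). Qed.

(* The degree j part of the i-th free module is its part of degree j - i before
   shifting.  Three cases: below 0 it vanishes; at 0 the cover is injective and
   the next term vanishes; above 0 the cover is exact. *)
Let exact_at i j (x : grfree A (@deg i) j) :
  (0 <= j - i%:Z -> g i (j - i%:Z) x = 0) <->
  exists y : grfree A (@deg i.+1) j, forall l, frmap (@diff i) y l = x l.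
Proof.
have [t0|t0] := ltP (j - i%:Z) 0.
  split=> [_|_ t1]; last by lia.
  by exists (fun=> 0) => l; rewrite frmap0 (neg0 x).
have glin := gfun_linear (g i) t0.
have [t1|t1] := ltP (j - i.+1%:Z) 0.
  have ti : j - i%:Z = 0 by lia.
  split=> [/(_ isT) gx|[y yx] _].
    exists (fun=> 0) => l; rewrite frmap0.
    suff -> : x = (fun=> 0) by [].
    by apply: (ginj ti); rewrite gx [RHS](lin0 glin).
  suff -> : x = (fun=> 0) by apply: (lin0 glin).
  apply: functional_extensionality_dep => l.
  by rewrite -yx (neg0 y) ?frmap0.
have [inj surj ex] := cexact (C i) t1.
pose e := shifted i j.
have xE : x = tr e (tr (esym e) (x : gpow 'I_(r i) (greg A) (j - i%:Z))).
  by rewrite trK.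
have gxE : (true -> g i (j - i%:Z) x = 0) <->
    g i (j - i.+1%:Z + 1) (tr (esym e) (x : gpow 'I_(r i) (greg A) (j - i%:Z))) = 0.
  rewrite gfun_tr; split=> [-> //|gx _].
    exact: (lin0 (@tr_linear K (gm (sval (syz i))) _ _ _)).
  apply: (@tr_inj K (gm (sval (syz i))) _ _ (esym e)); rewrite gx.
  by rewrite (lin0 (@tr_linear K (gm (sval (syz i))) _ _ _)).
refine (iff_trans gxE _); refine (iff_trans (ex _) _); split=> [[y fy]|[y yx]].
  have [z zy] := cgen_onto (C i.+1) y t1.
  exists z => l; rewrite diffE // [g _ _ _]zy [f _ _ _]fy.
  by rewrite [in RHS]xE [RHS]tr_gpow.
exists (g i.+1 (j - i.+1%:Z) y); apply: (@tr_inj K (gm (gpow 'I_(r i) (greg A))) _ _ e).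
by rewrite -xE; apply/funext => l; rewrite -yx diffE // tr_gpow.
Qed.

Let surj0 j (m : M j) : exists x : grfree A (@deg 0%N) j,
  fraug (fun k => g 0%N 0 (gbase k) : M (deg k)) x = m.
Proof.
have [j0|j0] := ltP j 0.
  by exists (fun=> 0); rewrite [LHS](M_neg j0) [RHS](M_neg j0).
have j0' : 0 <= j - 0%N%:Z by lia.
have [x xm] := cgen_onto (C 0%N) (tr (esym (aug_deg j)) m : M _) j0'.
by exists x; rewrite augE // [g _ _ _]xm trK.
Qed.

Let exact0 j (x : grfree A (@deg 0%N) j) :
  fraug (fun k => g 0%N 0 (gbase k) : M (deg k)) x = 0 <->
  exists y : grfree A (@deg 1%N) j, forall l, frmap (@diff 0%N) y l = x l.
Proof.
rewrite -exact_at; have [j0|j0] := ltP j 0.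
  by split=> [_|_]; [lia | apply: M_neg].
rewrite augE //; have j0' : 0 <= j - 0%N%:Z by lia.
have t0 := lin0 (@tr_linear K (gm M) _ _ (aug_deg j)).
split=> [gx _|-> //]; apply: (@tr_inj K (gm M) _ _ (aug_deg j)).
by rewrite gx t0.
Qed.

Let exactS i j (x : grfree A (@deg i.+1) j) :
  (forall l, frmap (@diff i) x l = 0) <->
  exists y : grfree A (@deg i.+2) j, forall l, frmap (@diff i.+1) y l = x l.
Proof.
rewrite -exact_at; split=> [fx t0|gx l].
  have [inj _ _] := cexact (C i) t0; apply: inj.
  rewrite (lin0 (gfun_linear (cinc (C i)) t0)); apply/funext => l.
  apply: (@tr_inj K (gm (greg A)) _ _ (shifted i j)).
  rewrite [LHS](esym (diffE _ _ _)) // fx.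
  by rewrite (lin0 (@tr_linear K (gm (greg A)) _ _ _)).
have [t0|t0] := ltP (j - i.+1%:Z) 0; first by rewrite (neg0 x) // frmap0.
rewrite diffE // gx // (lin0 (gfun_linear (f i) t0)).
exact: (lin0 (@tr_linear K (gm (greg A)) _ _ _)).
Qed.

Lemma linmod_resolution :
  exists F : grres M, forall i (k : 'I_(frk F i)), fdeg F i k = i%:Z.
Proof. by exists (GrRes surj0 exact0 exactS). Qed.
End LinearResolution.

(** * Homology of a module tensored with a resolution *)

Lemma choice_dep (I : Type) (T : I -> Type) (P : forall i, T i -> Prop) :
  (forall i, exists x, P i x) -> exists f : forall i, T i, forall i, P i (f i).
Proof. by move=> ex; exists (fun i => sval (cid (ex i))) => i; apply: svalP. Qed.

Section Tensor.
Variables (K : fieldType) (A : gralg K) (M : grmod A).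

(** The component of degree j of the tensor product of M with the free module on
generators of degrees d. *)
Definition tens n (d : 'I_n -> int) (j : int) := forall k : 'I_n, M (j - d k).

Definition tdiff n' n (d' : 'I_n' -> int) (d : 'I_n -> int)
    (phi : forall k l, A (d' k - d l)) j (x : tens d' j) : tens d j :=
  fun l => \sum_k gact M (etrans (addrC _ _) (subrKA (d' k) j (- d l)))
    (phi k l) (x k).

Variables (X : grmod A) (F : grres X).

Definition tcycle h j : tens (fdeg F h) j -> Prop :=
  if h is h'.+1 then fun x => forall l, tdiff (fdiff F h') x l = 0 else fun=> True.

(** Vanishing of the homology of M (x) F in homological degree h and internal
degree j, that is of Tor_h(M, X)_j when F resolves X. *)
Definition torvan h j := forall x : tens (fdeg F h) j, tcycle x ->
  exists y : tens (fdeg F h.+1) j, forall l, tdiff (fdiff F h) y l = x l.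

End Tensor.
Arguments torvan {K A} M {X} F h j.

Section FreeMaps.
Variables (K : fieldType) (A : stdgr K).

Lemma frmapB n' n (d' : 'I_n' -> int) (d : 'I_n -> int)
    (phi : forall k l, A (d' k - d l)) j (x y : grfree A d' j) l :
  frmap phi (fun k => x k - y k) l = frmap phi x l - frmap phi y l.
Proof.
rewrite /frmap -sumrB; apply: eq_bigr => k _.
exact: (linB (@gmul_linearl _ A _ _ _ (subrKA (d' k) j (- d l)) (phi k l))).
Qed.

Lemma fraugB (M : grmod A) n (d : 'I_n -> int) (g : forall k, M (d k)) j
    (x y : grfree A d j) :
  fraug g (fun k => x k - y k) = fraug g x - fraug g y.
Proof.
rewrite /fraug -sumrB; apply: eq_bigr => k _.
exact: (linB (gact_linearl (subrK (d k) j) (g k))).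
Qed.

(** Both sides are x y m; the point is to absorb the transports. *)
Lemma gact_swap (M : grmod A) (i b b' l bl k t t' : int) (s' : b = b')
    (e3 : b' + l = bl) (e4 : i + bl = k) (e6 : b + i = t) (s : t = t')
    (e5 : t' + l = k) (x : A i) (y : A b) (m : M l) :
  gact M e4 x (gact M e3 (tr s' y) m) = gact M e5 (tr s (gmul A e6 y x)) m.
Proof.
case: t' / s e5 => e5; case: b' / s' e3 => e3; rewrite !tr_id.
have e7 : i + b = t by rewrite addrC.
by rewrite (gmulC e6 e7) (gactA _ _ e3 e4).
Qed.

(** Both sides are y x a, with the factors a and x taken in either order. *)
Lemma gmul_swap (b b' i t t' u v w w' z : int) (s1 : t = t')
    (e1 : t' + i = z) (s2 : b = b') (e2 : b' + u = t) (s3 : w = z)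
    (e5 : b + i = v) (s4 : v = w') (e4 : w' + u = w)
    (y : A b) (a : A i) (x : A u) :
  gmul A e1 (tr s1 (gmul A e2 (tr s2 y) x)) a =
  tr s3 (gmul A e4 (tr s4 (gmul A e5 y a)) x).
Proof.
case: b' / s2 e2 => e2; case: t' / s1 e1 => e1; case: w' / s4 e4 => e4.
case: z / s3 e1 => e1; rewrite !tr_id.
have e6 : u + i = u + i by []. have e7 : i + u = u + i by rewrite addrC.
have e8 : b + (u + i) = w by rewrite addrA e2 e1.
by rewrite (gmulA e2 e1 e6 e8) (gmulA e5 e4 e7 e8) (gmulC e6 e7).
Qed.
End FreeMaps.

(** * Balancing two resolutions *)

Section Balance.
Variables (K : fieldType) (A : stdgr K) (X M : grmod A).
Variables (F : grres X) (G : grres M) (j : int).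
Local Notation a := (fdeg F).
Local Notation b := (fdeg G).

(* The term F_p (x) G_q in degree j.  A row is a family of elements of F_p, and
   so is a column for G_q once the order of subtraction is exchanged. *)
Let bic p q := forall (l : 'I_(frk G q)) (k : 'I_(frk F p)), A (j - b q l - a p k).

Let sw p q (l : 'I_(frk G q)) (k : 'I_(frk F p)) :
  j - b q l - a p k = j - a p k - b q l.
Proof. by rewrite addrAC. Qed.

Let col p q (w : bic p q) (k : 'I_(frk F p)) : grfree A (b q) (j - a p k) :=
  fun l => tr (V := A) (sw l k) (w l k).

Let uncol p q (w : forall k, grfree A (b q) (j - a p k)) : bic p q :=
  fun l k => tr (V := A) (esym (sw l k)) (w k l).

Let col_uncol p q (w : forall k, grfree A (b q) (j - a p k)) k l :
  col (uncol w) k l = w k l.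
Proof. exact: (@trK K A). Qed.

Let uncol_col p q (w : bic p q) l k : uncol (col w) l k = w l k.
Proof. exact: (@trK K A). Qed.

Let dh p q (w : bic p.+1 q) : bic p q := fun l => frmap (fdiff F p) (w l).
Let dv p q (w : bic p q.+1) : bic p q :=
  uncol (fun k => frmap (fdiff G q) (col w k)).
Let eh q (w : bic 0 q) : tens X (b q) j := fun l => fraug (@fgen _ _ _ F) (w l).
Let ev p (w : bic p 0) : tens M (a p) j := fun k => fraug (@fgen _ _ _ G) (col w k).

Let sub p q (w w' : bic p q) : bic p q := fun l k => w l k - w' l k.

Let ext2 p q (w w' : bic p q) : (forall l k, w l k = w' l k) -> w = w'.
Proof.
move=> ww; apply: functional_extensionality_dep => l.
by apply: functional_extensionality_dep => k.
Qed.

Let colB p q (w w' : bic p q) k l : col (sub w w') k l = col w k l - col w' k l.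
Proof. exact: (linB (@tr_linear K A _ _ _)). Qed.

Let dhB p q (w w' : bic p.+1 q) : dh (sub w w') = sub (dh w) (dh w').
Proof. by apply: ext2 => l k; apply: frmapB. Qed.

Let colBE p q (w w' : bic p q) k : col (sub w w') k = fun l => col w k l - col w' k l.
Proof. by apply: functional_extensionality_dep => l; apply: colB. Qed.

Let dvB p q (w w' : bic p q.+1) : dv (sub w w') = sub (dv w) (dv w').
Proof.
apply: ext2 => l k; rewrite /dv /uncol colBE frmapB.
exact: (linB (@tr_linear K A _ _ _)).
Qed.

Let evB p (w w' : bic p 0) k : ev (sub w w') k = ev w k - ev w' k.
Proof. by rewrite /ev colBE; apply: fraugB. Qed.

Let ehB q (w w' : bic 0 q) l : eh (sub w w') l = eh w l - eh w' l.
Proof. exact: fraugB. Qed.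

Let dhdh p q (w : bic p.+2 q) l k : dh (dh w) l k = 0.
Proof. by move: k; apply/fexact; exists (w l). Qed.

Let ehdh q (w : bic 1 q) l : eh (dh w) l = 0.
Proof. by apply/fexact0; exists (w l). Qed.

Let dvdv p q (w : bic p q.+2) l k : dv (dv w) l k = 0.
Proof.
have dw0 : frmap (fdiff G q) (col (dv w) k) l = 0.
  by move: l; apply/fexact; exists (col w k) => l; rewrite col_uncol.
by rewrite {1}/dv /uncol dw0; apply: (lin0 (@tr_linear K A _ _ _)).
Qed.

Let evdv p (w : bic p 1) k : ev (dv w) k = 0.
Proof. by apply/fexact0; exists (col w k) => l; rewrite col_uncol. Qed.

Let dh_exact p q (w : bic p.+1 q) : (forall l k, dh w l k = 0) -> exists v, dh v = w.
Proof.
move=> w0; have /choice_dep[v vE] l : exists v : grfree A (a p.+2) (j - b q l),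
    forall k, frmap (fdiff F p.+1) v k = w l k by apply/fexact/w0.
by exists v; apply: ext2 => l k; apply: vE.
Qed.
Let eh_exact q (w : bic 0 q) : (forall l, eh w l = 0) -> exists v, dh v = w.
Proof.
move=> w0; have /choice_dep[v vE] l : exists v : grfree A (a 1%N) (j - b q l),
    forall k, frmap (fdiff F 0%N) v k = w l k by apply/fexact0/w0.
by exists v; apply: ext2 => l k; apply: vE.
Qed.

Let dv_exact p q (w : bic p q.+1) : (forall l k, dv w l k = 0) -> exists v, dv v = w.
Proof.
move=> w0; have /choice_dep[v vE] k : exists v : grfree A (b q.+2) (j - a p k),
    forall l, frmap (fdiff G q.+1) v l = col w k l.
  apply/fexact => l; apply: (@tr_inj K A _ _ (esym (sw l k))).
  by rewrite [LHS](w0 l k) (lin0 (@tr_linear K A _ _ _)).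
exists (uncol v); apply: ext2 => l k; rewrite -[RHS]uncol_col /dv /uncol.
have -> : frmap (fdiff G q.+1) (col (uncol v) k) l = frmap (fdiff G q.+1) (v k) l.
  by apply: eq_bigr => t _; rewrite col_uncol.
by rewrite vE.
Qed.

Let ev_exact p (w : bic p 0) : (forall k, ev w k = 0) -> exists v, dv v = w.
Proof.
move=> w0; have /choice_dep[v vE] k : exists v : grfree A (b 1%N) (j - a p k),
    forall l, frmap (fdiff G 0%N) v l = col w k l by apply/fexact0/w0.
exists (uncol v); apply: ext2 => l k; rewrite -[RHS]uncol_col /dv /uncol.
have -> : frmap (fdiff G 0%N) (col (uncol v) k) l = frmap (fdiff G 0%N) (v k) l.
  by apply: eq_bigr => t _; rewrite col_uncol.
by rewrite vE.
Qed.

Let ev_surj p (y : tens M (a p) j) : exists w : bic p 0, forall k, ev w k = y k.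
Proof.
have /choice_dep[w wE] : forall k, exists w, fraug (@fgen _ _ _ G) w = y k.
  by move=> k; apply: fsurj.
exists (uncol w) => k; rewrite -wE; apply: eq_bigr => l _.
by rewrite col_uncol.
Qed.

Let eh_surj q (x : tens X (b q) j) : exists w : bic 0 q, forall l, eh w l = x l.
Proof.
by apply: (choice_dep (P := fun l w => fraug _ w = x l)) => l; apply: fsurj.
Qed.

Let ev_dh p (w : bic p.+1 0) k : ev (dh w) k = tdiff (fdiff F p) (ev w) k.
Proof.
rewrite /tdiff /ev /fraug.
under [RHS]eq_bigr => t _ do rewrite (lin_sum (gact_linear _ _)).
rewrite exchange_big /=; apply: eq_bigr => l _.
rewrite /col /dh /frmap (lin_sum (@tr_linear K A _ _ _)).
rewrite (lin_sum (gact_linearl _ _)); apply: eq_bigr => t _.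
exact: esym (gact_swap _ _ _ _ _ _ _ _ _).
Qed.

Let eh_dv q (w : bic 0 q.+1) l : eh (dv w) l = tdiff (fdiff G q) (eh w) l.
Proof.
rewrite /tdiff /eh /fraug.
under [RHS]eq_bigr => t _ do rewrite (lin_sum (gact_linear _ _)).
rewrite exchange_big /=; apply: eq_bigr => k _.
rewrite /dv /uncol /frmap (lin_sum (@tr_linear K A _ _ _)).
rewrite (lin_sum (gact_linearl _ _)); apply: eq_bigr => t _.
by rewrite -(uncol_col w t k); exact: esym (gact_swap _ _ _ _ _ _ _ _ _).
Qed.

Let dv_dh p q (w : bic p.+1 q.+1) : dv (dh w) = dh (dv w).
Proof.
apply: ext2 => l k; rewrite /dv /dh /uncol /frmap.
rewrite (lin_sum (@tr_linear K A _ _ _)).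
under [RHS]eq_bigr => t _ do
  rewrite (lin_sum (@tr_linear K A _ _ _)) (lin_sum (gmul_linearl _ _)).
rewrite exchange_big /=; apply: eq_bigr => t _.
rewrite /col (lin_sum (@tr_linear K A _ _ _)) (lin_sum (gmul_linearl _ _)).
rewrite (lin_sum (@tr_linear K A _ _ _)); apply: eq_bigr => s _.
by apply: esym; apply: gmul_swap.
Qed.

(* An element of F_p (x) G_q that is a vertical cycle modulo horizontal
   boundaries is a sum of boundaries.  Moving along the antidiagonal, from q to
   q - 1, replaces w by the w' with dv w = dh w'; at q = 0 the condition says
   that w induces a cycle of M (x) F, where the hypothesis applies. *)
Let staircase q p (w : bic p q) : torvan M F (q + p) j ->
  match q return bic p q -> Prop with
  | 0 => fun w => tcycle (F := F) (ev w)
  | q'.+1 => fun w => exists w', dv w = dh w'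
  end w ->
  exists (v : bic p.+1 q) (u : bic p q.+1), sub w (dh v) = dv u.
Proof.
elim: q p w => [|q IHq] p w van.
  move=> /van[y yw]; have [v vy] := ev_surj y; exists v.
  suff /ev_exact[u ue] : forall k, ev (sub w (dh v)) k = 0.
    by exists u; rewrite ue.
  move=> k; rewrite evB ev_dh -yw.
  have -> : ev v = y by apply: functional_extensionality_dep.
  by rewrite subrr.
case=> w' ww'.
have [||v [u vu]] := IHq p.+1 w'; first by rewrite addnS.
  case: q w w' ww' {IHq van} => [|q] w w' ww' /=.
    by move=> k; rewrite -ev_dh -ww' evdv.
  suff /dh_exact[v' v'E] : forall l k, dh (dv w') l k = 0 by exists v'.
  by move=> l k; rewrite -dv_dh -ww' dvdv.
exists u; suff /dv_exact[u' u'E] : forall l k, dv (sub w (dh u)) l k = 0.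
  by exists u'.
move=> l k; rewrite dvB ww' dv_dh -vu dhB /sub.
by rewrite (dhdh v) subr0 subrr.
Qed.

(** A cycle of X (x) G lifts to F_0 (x) G, where the staircase of the double
complex leads it to a cycle of M (x) F in the same degrees. *)
Lemma torvan_balance i : torvan M F i j -> torvan X G i j.
Proof.
move=> van x xcyc; have [w wx] := eh_surj x.
have [||v [u vu]] := @staircase i 0 w; first by rewrite addn0.
  case: i {van} x xcyc w wx => [|i] x xcyc w wx //.
  suff /eh_exact[w' w'E] : forall l, eh (dv w) l = 0 by exists w'.
  have ew : eh w = x by apply: functional_extensionality_dep.
  by move=> l; rewrite eh_dv ew; apply: xcyc.
exists (eh u) => l; rewrite -eh_dv -vu ehB ehdh subr0.
exact: wx.
Qed.
End Balance.

(** * Betti numbers as homology with coefficients in the residue field *)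

Section Rsum.
Variables (K : fieldType).

(** The component of degree j of the residue field consists of row vectors of
length j == 0, that is 1 or 0; summing the entries identifies it with K or 0. *)
Definition rsum n (v : 'rV[K]_n) : K := \sum_t v 0 t.

Lemma rsum_linear n : linear (@rsum n : 'rV[K]_n -> K^o).
Proof.
move=> a v w; rewrite /rsum scaler_sumr -big_split.
by apply: eq_bigr => t _; rewrite !mxE.
Qed.

Lemma rsum_inj (b : bool) : injective (@rsum b).
Proof.
case: b => v w; last by move=> _; apply/rowP; case.
by rewrite /rsum !big_ord1 => vw; apply/rowP => t; rewrite (ord1 t).
Qed.

Lemma rsum_const (b : bool) (a : K) : rsum (const_mx a : 'rV_b) = if b then a else 0.
Proof. by rewrite /rsum; case: b; rewrite ?big_ord1 ?mxE ?big_ord0. Qed.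

Lemma rsum_false (b : bool) (v : 'rV[K]_b) : ~~ b -> rsum v = 0.
Proof. by case: b v => // v _; rewrite /rsum big_ord0. Qed.

Lemma rsum_act (A : stdgr K) i j k (e : i + j = k) (a : A i) (v : resfield A j) :
  rsum (gact (resfield A) e a v : 'rV_(k == 0)) = aug a * rsum (v : 'rV_(j == 0)).
Proof.
rewrite /= /resfield_act; have [i0|i0] := eqVneq i 0; last first.
  by rewrite augN0 // mul0r scale0r (lin0 (@rsum_linear _)).
have jk : j = k by rewrite -e i0 add0r.
case: k / jk e => _.
by rewrite conform_mx_id (linZ (@rsum_linear _)).
Qed.
End Rsum.

Section FreeBase.
Variables (K : fieldType) (A : stdgr K).

(** The k-th basis vector of a free module; its coordinate 1 lives in the
component of degree d k - d k of A. *)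
Definition frbase n (d : 'I_n -> int) (k : 'I_n) : grfree A d (d k) :=
  fun l => if l =P k is ReflectT e
    then tr (V := A) (esym (etrans (congr1 (fun t => d k - d t) e) (subrr (d k))))
           (gone A)
    else 0.

Lemma frbaseE n (d : 'I_n -> int) (k : 'I_n) (e : 0 = d k - d k) :
  frbase d k k = tr (V := A) e (gone A).
Proof.
rewrite /frbase; case: eqP => // p; congr (tr _ _); exact: eq_irrelevance.
Qed.

Lemma frbaseN n (d : 'I_n -> int) (k l : 'I_n) : l != k -> frbase d k l = 0.
Proof. by rewrite /frbase; case: eqP. Qed.

Lemma frmap_base n' n (d' : 'I_n' -> int) (d : 'I_n -> int)
    (phi : forall k l, A (d' k - d l)) k l : frmap phi (frbase d' k) l = phi k l.
Proof.
rewrite /frmap (bigD1 k) //= big1 ?addr0 => [|t tk]; last first.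
  by rewrite frbaseN // gmul0l.
have e : 0 = d' k - d' k by rewrite subrr.
have e' : 0 + (d' k - d l) = d' k - d l by rewrite add0r.
rewrite (frbaseE e); apply: etrans (gmul1 e' _).
exact: (@gact_trl K A (greg A)).
Qed.

Variables (M : grmod A) (F : grres M).

Lemma frmap_fdiff i k l : frmap (fdiff F i) (fdiff F i.+1 k) l = 0.
Proof.
move: l; apply/fexact; exists (frbase _ k) => l; exact: frmap_base.
Qed.

Lemma fraug_fdiff k : fraug (@fgen _ _ _ F) (fdiff F 0 k) = 0.
Proof. by apply/fexact0; exists (frbase _ k) => l; apply: frmap_base. Qed.

Lemma tordiffM i : tordiff F i.+1 *m tordiff F i = 0.
Proof.
apply/matrixP => k l; rewrite !mxE.
transitivity (aug (frmap (fdiff F i) (fdiff F i.+1 k) l)); last first.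
  by rewrite frmap_fdiff; exact: (lin0 (@aug_linear K A _)).
rewrite /frmap (lin_sum (@aug_linear _ A _)).
by apply: eq_bigr => t _; rewrite !mxE augM.
Qed.

Lemma sub_torstrand i j m (v : 'M[K]_(m, frk F i)) :
  (v <= torstrand F i j)%MS <-> v *m torstrand F i j = v.
Proof.
split=> [/submxP[w ->]|<-]; last exact: submxMl.
rewrite -mulmxA; congr (_ *m _); apply/matrixP => k l.
rewrite mul_mx_diag !mxE; have [->|_] := eqVneq k l; last by rewrite mul0r.
by rewrite mulr1n; case: (_ == j); rewrite ?mulr1 ?mulr0.
Qed.

Lemma sub_torstrandP i j (v : 'rV[K]_(frk F i)) :
  (v <= torstrand F i j)%MS <-> forall k, fdeg F i k != j -> v 0 k = 0.
Proof.
split=> [/sub_torstrand<- k /negPf kj|v0].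
  by rewrite mul_mx_diag !mxE kj mulr0.
apply/sub_torstrand/rowP => k; rewrite mul_mx_diag !mxE.
by case: eqP => kj; rewrite ?mulr1 // v0 ?mulr0 //; apply/eqP.
Qed.

Definition torrow i j (x : tens (resfield A) (fdeg F i) j) : 'rV[K]_(frk F i) :=
  \row_k rsum (x k : 'rV_((j - fdeg F i k) == 0)).

Lemma torrow_strand i j (x : tens (resfield A) (fdeg F i) j) :
  (torrow x <= torstrand F i j)%MS.
Proof.
apply/sub_torstrandP => k kj; rewrite mxE rsum_false //.
by rewrite subr_eq0 eq_sym.
Qed.

Lemma torrow_inj i j (x y : tens (resfield A) (fdeg F i) j) :
  torrow x = torrow y -> forall k, x k = y k.
Proof. by move=> /rowP xy k; have := xy k; rewrite !mxE; apply: rsum_inj. Qed.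

Lemma torrow0 i j : torrow (fun k => 0 : resfield A (j - fdeg F i k)) = 0.
Proof. by apply/rowP => k; rewrite !mxE; exact: (lin0 (@rsum_linear K _)). Qed.

Lemma torrow_onto i j (v : 'rV[K]_(frk F i)) : (v <= torstrand F i j)%MS ->
  exists x : tens (resfield A) (fdeg F i) j, torrow x = v.
Proof.
move=> /sub_torstrandP v0.
exists (fun k => const_mx (v 0 k) : 'rV_((j - fdeg F i k) == 0)).
apply/rowP => k; rewrite !mxE rsum_const; case: eqP => // kj; rewrite v0 //.
by apply/eqP => kj'; case: kj; rewrite kj' subrr.
Qed.

Lemma torrow_tdiff i j (x : tens (resfield A) (fdeg F i.+1) j) :
  torrow (tdiff (fdiff F i) x) = torrow x *m tordiff F i.
Proof.
apply/rowP => l; rewrite !mxE /tdiff (lin_sum (@rsum_linear _ _)).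
by apply: eq_bigr => k _; rewrite rsum_act !mxE mulrC.
Qed.

Lemma tcycleP i j (x : tens (resfield A) (fdeg F i) j) :
  tcycle (F := F) x <-> (torrow x <= torcycles F i)%MS.
Proof.
case: i x => [|i] x /=; first by rewrite submx1.
rewrite sub_kermx -torrow_tdiff; split=> [x0|/eqP x0 l].
  by rewrite -(torrow0 i j); apply/eqP/rowP => l; rewrite !mxE x0.
by rewrite -(torrow0 i j) in x0; rewrite (torrow_inj x0).
Qed.

(** The dimension of the homology is a truncated difference of ranks; it detects
vanishing because the boundaries are contained in the cycles, which uses that
the composite of two differentials is 0 and that they preserve degrees. *)
Lemma tordim_torvan i j : tordim F i j = 0%N <-> torvan (resfield A) F i j.
Proof.
pose Z := (torcycles F i :&: torstrand F i j)%MS.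
pose B := torstrand F i.+1 j *m tordiff F i.
have -> : tordim F i j = 0%N <-> (Z <= B)%MS.
  have BZ : (B <= Z)%MS.
    rewrite sub_capmx; apply/andP; split.
      rewrite /B; case: (i) => [|i'] /=; first exact: submx1.
      by apply/sub_kermxP; rewrite -mulmxA tordiffM mulmx0.
    apply/sub_torstrand/matrixP => k l.
    rewrite /B mul_mx_diag mul_diag_mx !mxE.
    case: eqP => kj; last by rewrite !mul0r.
    case: eqP => lj; first by rewrite mulr1.
    rewrite augN0 ?mulr0 ?mul0r // subr_eq0; apply/eqP => kl.
    by case: lj; rewrite -kl.
  split=> [|ZB]; last by apply/eqP; rewrite subn_eq0 mxrankS.
  by move/eqP; rewrite subn_eq0 (geq_leqif (mxrank_leqif_sup BZ)).
split=> [ZB x /tcycleP xc|van].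
  have /submxP[w xw] : (torrow x <= B)%MS.
    by apply: submx_trans ZB; rewrite sub_capmx xc torrow_strand.
  have [y yw] := torrow_onto (submxMl w (torstrand F i.+1 j)).
  exists y; apply: torrow_inj.
  by rewrite torrow_tdiff yw xw mulmxA.
apply/row_subP => k; have : (row k Z <= Z)%MS by apply: row_sub.
rewrite sub_capmx => /andP[kc /torrow_onto[x xk]].
rewrite -xk in kc *; have [y yx] := van x (iffRL (tcycleP x) kc).
have -> : torrow x = torrow (tdiff (fdiff F i) y).
  by apply/rowP => l; rewrite !mxE yx.
rewrite torrow_tdiff /B; have /sub_torstrand<- := torrow_strand y.
by rewrite -mulmxA submxMl.
Qed.
End FreeBase.

(** * From vanishing homology to linear modules *)

Section FiniteDimension.
Variable K : fieldType.

Definition spanning (V : lmodType K) n (v : 'I_n -> V) :=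
  forall x, exists a : 'I_n -> K, x = \sum_t a t *: v t.

Definition independent (V : lmodType K) n (v : 'I_n -> V) :=
  forall a : 'I_n -> K, \sum_t a t *: v t = 0 -> forall t, a t = 0.

(** Bounding the size of independent families makes this evidently hereditary
for subspaces, which is how it is used for syzygies. *)
Definition findim (V : lmodType K) :=
  exists N, forall m (u : 'I_m -> V), independent u -> (m <= N)%N.

Lemma spanning_findim (V : lmodType K) n (v : 'I_n -> V) : spanning v -> findim V.
Proof.
move=> vspan; exists n => m u uind.
have /choice[c cE] k : exists a : 'I_n -> K, u k = \sum_t a t *: v t by [].
pose C := \matrix_(k, t) c k t.
suff /eqP <- : row_free C by apply: rank_leq_col.
apply: inj_row_free => w wC; apply/rowP => k; rewrite mxE.
apply: (uind (fun k => w 0 k)).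
under eq_bigr => t _ do rewrite cE scaler_sumr.
rewrite exchange_big /= big1 // => t _.
under eq_bigr => k' _ do rewrite scalerA.
rewrite -scaler_suml; suff -> : \sum_i w 0 i * c i t = (w *m C) 0 t.
  by rewrite wC mxE scale0r.
by rewrite mxE; apply: eq_bigr => i _; rewrite mxE.
Qed.

Lemma findim_inj (U V : lmodType K) (f : U -> V) :
  linear f -> injective f -> findim V -> findim U.
Proof.
move=> flin finj [N Nmax]; exists N => m u uind; apply: (Nmax m (f \o u)).
move=> a fa0; apply: uind; apply: finj; rewrite (lin0 flin) -fa0 (lin_sum flin).
by apply: eq_bigr => t _; rewrite (linZ flin).
Qed.

Lemma findim_pow (V : lmodType K) p (v : 'I_p -> V) m :
  spanning v -> findim ('I_m -> V).
Proof.
move=> vspan; pose T : finType := ('I_m * 'I_p)%type.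
pose w (s : 'I_#|T|) : 'I_m -> V := fun i =>
  if i == (enum_val s).1 then v (enum_val s).2 else 0.
apply: (@spanning_findim _ _ w) => x.
have /choice[c cE] i : exists a : 'I_p -> K, x i = \sum_t a t *: v t by [].
exists (fun s => c (enum_val s).1 (enum_val s).2); apply/funext => i.
rewrite fct_sumE.
transitivity (\sum_(s : T) c s.1 s.2 *: (if i == s.1 then v s.2 else 0)); last first.
  by rewrite (reindex _ (onW_bij _ (enum_val_bij T))).
rewrite cE -(pair_bigA _ (fun k t => c k t *: (if i == k then v t else 0))) /=.
rewrite (bigD1 i) //= eqxx [X in _ + X]big1 ?addr0 // => k ki.
by apply: big1 => t _; rewrite eq_sym (negPf ki) scaler0.
Qed.

Lemma findim_basis (V : lmodType K) : findim V ->
  exists n (v : 'I_n -> V), independent v /\ spanning v.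
Proof.
case=> N Nmax.
pose Q m := `[< exists u : 'I_m -> V, independent u >].
have exQ : exists m, Q m.
  by exists 0%N; apply/asboolP; exists (fun=> 0) => a _ [].
have leQ m : Q m -> (m <= N)%N by move=> /asboolP[u /Nmax].
case: (ex_maxnP exQ leQ) => n /asboolP[v vind] nmax; exists n, v; split=> // x.
pose u (i : 'I_n.+1) := if unlift ord0 i is Some t then v t else x.
have /existsNP[a /not_implyP[a0 /existsNP[i ai]]] : ~ independent u.
  move=> uind; suff : (n.+1 <= n)%N by rewrite ltnn.
  by apply: nmax; apply/asboolP; exists u.
move: a0; rewrite big_ord_recl /u unlift_none.
under eq_bigr => t _ do rewrite liftK.
have [a00|a00] := eqVneq (a ord0) 0.
  rewrite a00 scale0r add0r => /vind at0; case: ai.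
  by case: (unliftP ord0 i) => [t ->|->].
move=> /eqP; rewrite addr_eq0 => /eqP ax.
exists (fun t => - (a ord0)^-1 * a (lift ord0 t)).
rewrite -[LHS](scalerK a00) ax scalerN -scaleNr scaler_sumr.
by apply: eq_bigr => t _; rewrite scalerA.
Qed.
End FiniteDimension.

Section Free.
Variables (K : fieldType) (A : stdgr K) (M : grmod A).
Variables (n : nat) (v : 'I_n -> M 0).

Let gen_fun j (x : gpow 'I_n (greg A) j) : M j :=
  \sum_k gact M (addr0 j) (x k) (v k).

Fact gen_linear j : linear (@gen_fun j).
Proof.
move=> a x y; rewrite /gen_fun scaler_sumr -big_split; apply: eq_bigr => k _ /=.
by rewrite -gact_linearl.
Qed.

Fact gen_act i j k (e : i + j = k) (a : A i) (x : gpow 'I_n (greg A) j) :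
  gen_fun (gact _ e a x) = gact M e a (gen_fun x).
Proof.
rewrite /gen_fun (lin_sum (gact_linear e a)); apply: eq_bigr => t _.
exact: gactA.
Qed.

Definition ggen : ghom (gpow 'I_n (greg A)) M :=
  GHom (fun j _ => @gen_linear j) (fun i j k e a x _ _ => gen_act e a x).

Lemma ggenE (x : gpow 'I_n (greg A) 0) : ggen 0 x = \sum_k deg0 (x k) *: v k.
Proof.
apply: eq_bigr => k _; rewrite -{1}(deg0K (x k)).
by rewrite (linZ (gact_linearl _ _)) gact1.
Qed.

Lemma ggen_inj : independent v -> injective (ggen 0).
Proof.
move=> vind; apply: lin_inj; first exact: gfun_linear.
move=> x; rewrite ggenE => /(vind (fun k => deg0 (x k))) x0.
by apply/funext => k; rewrite -(deg0K (x k)) x0 scale0r.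
Qed.

Lemma ggen_surj0 : spanning v -> forall m, exists x, ggen 0 x = m.
Proof.
move=> vspan m; have [a ->] := vspan m.
exists (fun k => a k *: gone A); rewrite ggenE.
by apply: eq_bigr => k _; rewrite deg0Z.
Qed.
End Free.

Section TorVanishing.
Variables (K : fieldType) (A : stdgr K) (F : grres (resfield A)).

Lemma aug_lift d (v : resfield A d) : exists a : A d, aug a = rsum (v : 'rV_(d == 0)).
Proof.
have [d0|/eqP d0] := pselect (d = 0); last first.
  by exists 0; rewrite rsum_false // augN0.
subst d; exists (rsum (v : 'rV_(0 == 0 :> int)) *: gone A).
by rewrite [LHS](linZ (@aug_linear K A 0)) aug1 [LHS]mulr1.
Qed.

Lemma rsum_fraug n (d : 'I_n -> int) (g : forall k, resfield A (d k)) j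
    (x : grfree A d j) :
  rsum (fraug g x : 'rV_(j == 0)) = \sum_k aug (x k) * rsum (g k : 'rV_(d k == 0)).
Proof.
rewrite /fraug (lin_sum (@rsum_linear _ _)).
by apply: eq_bigr => k _; apply: rsum_act.
Qed.

Lemma aug_eq0 i (a : A i) : i <= 0 -> aug a = 0 -> a = 0.
Proof.
rewrite le_eqVlt => /orP[/eqP i0|i0 _]; last exact: sg_neg.
by move: a; rewrite i0 => a; rewrite aug0 => a0; rewrite -(deg0K a) a0 scale0r.
Qed.

Section Generation.
Variables (M : grmod A) (S : forall j, M j -> Prop).
Hypothesis M_neg : forall j, j < 0 -> forall x : M j, x = 0.
Hypothesis S0 : forall j, 0 <= j -> @S j 0.
Hypothesis SD : forall j, 0 <= j -> forall x y : M j, S x -> S y -> S (x + y).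
Hypothesis Sact : forall i j k (e : i + j = k) (a : A i) (x : M j),
  0 <= i -> 0 <= j -> S x -> S (gact M e a x).

(** Nakayama's argument for the positive part A_+ of A.  Lift 1 to the degree 0
part of F_0, and the augmentation F_0 -> K to elements a of A.  The product of m
with the lift of 1 is a boundary of M (x) F_0; applying a to it gives back m on
one side, and on the other a combination of products by elements of augmentation
0, since F_1 -> F_0 -> K vanishes. *)
Lemma torvan0_decomp j (m : M j) : torvan M F 0 j ->
  exists (b : forall k, A (fdeg F 1 k)) (z : tens M (fdeg F 1) j),
    (forall k, aug (b k) = 0) /\
    m = \sum_k gact M (etrans (addrC _ _) (subrK (fdeg F 1 k) j)) (b k) (z k).
Proof.
move=> van; have [x0 x0E] := fsurj F (const_mx 1 : resfield A 0).
have /choice_dep[a aE] := fun l => aug_lift (@fgen _ _ _ F l).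
have ye l : 0 - fdeg F 0 l + j = j - fdeg F 0 l by rewrite add0r addrC.
have [z zE] := van (fun l => gact M (ye l) (x0 l) m) I.
have be k l : fdeg F 0 l + (fdeg F 1 k - fdeg F 0 l) = fdeg F 1 k.
  by rewrite addrC subrK.
exists (fun k => \sum_l gmul A (be k l) (a l) (fdiff F 0 k l)), z; split.
  move=> k; rewrite (lin_sum (@aug_linear _ A _)).
  transitivity (rsum (fraug (@fgen _ _ _ F) (fdiff F 0 k))).
    by rewrite rsum_fraug; apply: eq_bigr => l _; rewrite augM mulrC aE.
  by rewrite fraug_fdiff; apply: (lin0 (@rsum_linear K _)).
have me l : fdeg F 0 l + (j - fdeg F 0 l) = j by rewrite addrC subrK.
transitivity (\sum_l gact M (me l) (a l) (gact M (ye l) (x0 l) m)).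
  have e0 l : fdeg F 0 l + (0 - fdeg F 0 l) = 0 by rewrite addrC subrK.
  under eq_bigr => l _ do rewrite -(gactA (e0 l) (add0r j)).
  rewrite -(lin_sum (gact_linearl _ _)).
  have -> : \sum_l gmul A (e0 l) (a l) (x0 l) = gone A; last by rewrite gact1.
  rewrite -[LHS]deg0K -[RHS]scale1r; congr (_ *: _); rewrite -aug0.
  rewrite (lin_sum (@aug_linear _ A _)).
  transitivity (rsum (fraug (@fgen _ _ _ F) x0)).
    by rewrite rsum_fraug; apply: eq_bigr => l _; rewrite augM mulrC aE.
  by rewrite x0E; apply: rsum_const.
under eq_bigr => l _ do rewrite -zE /tdiff (lin_sum (gact_linear _ _)).
rewrite exchange_big /=; apply: eq_bigr => k _.
rewrite (lin_sum (gact_linearl _ _)); apply: eq_bigr => l _.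
exact/esym/gactA.
Qed.

Lemma torvan0_generation :
    (forall x : M 0, S x) -> (forall j, 0 < j -> torvan M F 0 j) ->
  forall j, 0 <= j -> forall m : M j, S m.
Proof.
move=> S_deg0 van; case=> // n _; elim/ltn_ind: n => -[|n] IHn m //.
have [//|b [z [b0 ->]]] := torvan0_decomp m (van _ _).
have n0 : 0 <= n.+1%:Z by [].
(* Factors b k of degree <= 0 vanish, the others lower the degree of z k. *)
apply: (big_ind (@S _)); [exact: S0 | exact: SD | move=> k _].
have [d0|d0] := leP (fdeg F 1 k) 0.
  by rewrite (aug_eq0 d0 (b0 k)) gactl0; apply: S0.
move: (etrans _ _) (z k) (b k) d0; move: (fdeg F 1 k) => d e zk bk d0.
have [j0|j0] := ltP (n.+1%:Z - d) 0.
  by rewrite (M_neg j0 zk) gact0; apply: S0.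
apply: Sact => //; first exact: ltW.
move: (n.+1%:Z - d) e j0 zk => j e; case: j e => // p e _ zk.
by apply: IHn; lia.
Qed.
End Generation.

Lemma tdiff_tdiff (M : grmod A) h j (x : tens M (fdeg F h.+2) j) l :
  tdiff (fdiff F h) (tdiff (fdiff F h.+1) x) l = 0.
Proof.
rewrite /tdiff; under eq_bigr => t _ do rewrite (lin_sum (gact_linear _ _)).
rewrite exchange_big /= big1 // => k _.
transitivity (gact M (etrans (addrC _ _) (subrKA (fdeg F h.+2 k) j (- fdeg F h l)))
  (frmap (fdiff F h) (fdiff F h.+1 k) l) (x k)); last first.
  by rewrite frmap_fdiff gactl0.
rewrite /frmap (lin_sum (gact_linearl _ _)); apply: eq_bigr => t _.
have e : fdeg F h.+1 t - fdeg F h l + (fdeg F h.+2 k - fdeg F h.+1 t) =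
    fdeg F h.+2 k - fdeg F h l by rewrite addrC subrKA.
by rewrite (gmulC _ e); apply/esym/gactA.
Qed.

Lemma tdiff_greg h j (x : tens (greg A) (fdeg F h.+1) j) l :
  tdiff (fdiff F h) x l = frmap (fdiff F h) (x : grfree A _ j) l.
Proof. by apply: eq_bigr => k _; apply: gmulC. Qed.

Lemma tdiff_gpow (M : grmod A) n h j
    (x : tens (gpow 'I_n M) (fdeg F h.+1) j) l i :
  tdiff (fdiff F h) x l i = tdiff (fdiff F h) (fun k => x k i : M _) l.
Proof. by rewrite /tdiff fct_sumE. Qed.

(** F is exact in homological degrees h > 0, and for h = 0 its homology is the
residue field, which vanishes in degrees j > 0. *)
Lemma torvan_greg h j : 0 < j -> torvan (greg A) F h j.
Proof.
move=> j0 x xcyc.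
suff [y yx] : exists y : grfree A (fdeg F h.+1) j,
    forall l, frmap (fdiff F h) y l = x l.
  by exists y => l; rewrite tdiff_greg yx.
case: h x xcyc => [|h] x xcyc; last by apply/fexact => l; rewrite -tdiff_greg xcyc.
apply/fexact0; apply: rsum_inj; rewrite !rsum_false //; apply/eqP; lia.
Qed.

Lemma torvan_gpow (M : grmod A) n h j :
  torvan M F h j -> torvan (gpow 'I_n M) F h j.
Proof.
move=> van x xcyc.
have /choice[y yE] (i : 'I_n) : exists y : tens M (fdeg F h.+1) j,
    forall l, tdiff (fdiff F h) y l = x l i.
  apply: van; case: h x xcyc => // h x xcyc l.
  by have := congr1 (fun w => w i) (xcyc l); rewrite tdiff_gpow.
exists (fun k i => y i k) => l; apply/funext => i.
by rewrite tdiff_gpow yE.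
Qed.

Section KernelVanishing.
Variables (M P : grmod A) (g : ghom P M).
Hypothesis M_neg : forall j, j < 0 -> forall x : M j, x = 0.
Hypothesis P_neg : forall j, j < 0 -> forall x : P j, x = 0.
Hypothesis g_surj : forall j, 0 <= j -> forall m : M j, exists x, g j x = m.

Let g0 j : g j 0 = 0.
Proof.
have [j0|j0] := ltP j 0; first exact: M_neg.
exact: (lin0 (gfun_linear g j0)).
Qed.

Let glin j : linear (g j).
Proof.
have [j0|j0] := ltP j 0; last exact: gfun_linear.
by move=> a x y; rewrite [LHS](M_neg j0) [RHS](M_neg j0).
Qed.

Let gact_ i j k (e : i + j = k) (a : A i) (x : P j) :
  g k (gact P e a x) = gact M e a (g j x).
Proof.
have [i0|i0] := ltP i 0; first by rewrite (sg_neg i0 a) !gactl0 g0.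
have [j0|j0] := ltP j 0; first by rewrite (P_neg j0 x) g0 !gact0 g0.
exact: gfun_act.
Qed.

Let gtens n (d : 'I_n -> int) j (x : tens P d j) : tens M d j := fun k => g _ (x k).

Let gtens_tdiff h j (x : tens P (fdeg F h.+1) j) l :
  tdiff (fdiff F h) (gtens x) l = g _ (tdiff (fdiff F h) x l).
Proof.
rewrite /tdiff (lin_sum (@glin _)); apply: eq_bigr => k _.
by rewrite gact_.
Qed.

Let vtens n (d : 'I_n -> int) j (x : tens (gker g) d j) : tens P d j :=
  fun k => kval (x k).

Let kval_sum j (I : finType) (f : I -> gker g j) :
  kval (\sum_i f i) = \sum_i kval (f i).
Proof. exact: (raddf_sum (val : kert g j -> P j)). Qed.

Let vtens_tdiff h j (x : tens (gker g) (fdeg F h.+1) j) l :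
  tdiff (fdiff F h) (vtens x) l = kval (tdiff (fdiff F h) x l).
Proof. by rewrite /tdiff kval_sum. Qed.

Let ker_lift j (x : P j) : g j x = 0 -> in_ker g x.
Proof.
rewrite /in_ker; case: lerP => [_ ->|j0 _]; first by rewrite eqxx.
by rewrite (P_neg j0 x).
Qed.

(** The part H_(h+1)(M) -> H_h(ker g) -> H_h(P) of the long exact sequence of
Tor. *)
Lemma torvan_gker h j : torvan M F h.+1 j -> torvan P F h j ->
  torvan (gker g) F h j.
Proof.
move=> vanM vanP x xcyc.
have [|w wx] := vanP (vtens x).
  case: h x xcyc {vanM vanP} => // h x xcyc l.
  by rewrite vtens_tdiff xcyc.
have [|v' v'E] := vanM (gtens w).
  move=> l; rewrite gtens_tdiff wx.
  have := kvalP (x l); rewrite /in_ker; case: lerP => [_ /eqP //|j0 _].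
  exact: M_neg.
have /choice_dep[v vE] k : exists v, g (j - fdeg F h.+2 k) v = v' k.
  have [j0|j0] := ltP (j - fdeg F h.+2 k) 0; last exact: g_surj.
  by exists 0; rewrite [LHS](M_neg j0) [RHS](M_neg j0).
have ev : gtens v = v' by apply: functional_extensionality_dep.
have uker k : in_ker g (w k - tdiff (fdiff F h.+1) v k).
  apply: ker_lift; rewrite (linB (@glin _)) -gtens_tdiff ev v'E.
  exact: subrr.
exists (fun k => Kert (uker k)) => l; apply: val_inj => /=.
rewrite -vtens_tdiff -[RHS]wx.
transitivity (tdiff (fdiff F h) w l -
  tdiff (fdiff F h) (tdiff (fdiff F h.+1) v) l).
  rewrite /tdiff -sumrB; apply: eq_bigr => k _.
  exact: (linB (gact_linear _ _)).
by rewrite tdiff_tdiff subr0.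
Qed.
End KernelVanishing.

Lemma torvan_gshift (M : grmod A) h j : torvan M F h (j + 1) ->
  torvan (gshift 1 M) F h j.
Proof.
have e (d : int) : j - d + 1 = j + 1 - d by rewrite addrAC.
pose T n (d : 'I_n -> int) (x : tens (gshift 1 M) d j) : tens M d (j + 1) :=
  fun k => tr (V := gm M) (e (d k)) (x k).
pose T' n (d : 'I_n -> int) (x : tens M d (j + 1)) : tens (gshift 1 M) d j :=
  fun k => tr (V := gm M) (esym (e (d k))) (x k).
have TE h' (x : tens (gshift 1 M) (fdeg F h'.+1) j) l :
    tdiff (fdiff F h') (T _ _ x) l = tr (V := gm M) (e _) (tdiff (fdiff F h') x l).
  rewrite /tdiff (lin_sum (@tr_linear K (gm M) _ _ _)); apply: eq_bigr => k _.
  have e' : fdeg F h'.+1 k - fdeg F h' l + (j - fdeg F h'.+1 k + 1) = j + 1 - fdeg F h' l.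
    by lia.
  by rewrite [LHS](gact_tr e') [RHS](tr_gact _ e').
move=> van x xcyc; have [|y yE] := van (T _ _ x).
  case: h x xcyc {van} => // h x xcyc l; rewrite TE xcyc.
  exact: (lin0 (@tr_linear K (gm M) _ _ _)).
exists (T' _ _ y) => l; apply: (@tr_inj K (gm M) _ _ (e _)); rewrite -TE.
have -> : T _ _ (T' _ _ y) = y.
  by apply: functional_extensionality_dep => k; apply: trK.
exact: yE.
Qed.

(** The bound on internal degrees that a linear resolution of M would give for
Tor against the residue field. *)
Definition torlin (M : grmod A) :=
  (forall j, j < 0 -> forall x : M j, x = 0) /\
  forall h j, h%:Z < j -> torvan M F h j.

Lemma gpow_neg n j : j < 0 -> forall x : gpow 'I_n (greg A) j, x = 0.
Proof. by move=> j0 x; apply/funext => k; apply: sg_neg. Qed.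

Lemma torlin_surj (M : grmod A) n (g : ghom (gpow 'I_n (greg A)) M) :
    torlin M -> (forall m, exists x, g 0 x = m) ->
  forall j, 0 <= j -> forall m : M j, exists x, g j x = m.
Proof.
move=> [M_neg van] g0; apply: torvan0_generation => //.
- by move=> j j0; exists 0; apply: (lin0 (gfun_linear g j0)).
- by move=> j j0 _ _ [x <-] [y <-]; exists (x + y); apply: (linD (gfun_linear g j0)).
- by move=> i j k e a _ i0 j0 [x <-]; exists (gact _ e a x); apply: gfun_act.
- by move=> j j0; apply: van.
Qed.

(** The free cover contributes nothing to Tor in positive degrees, so the
syzygies inherit the bound of M, one homological degree lower. *)
Lemma torlin_gker (M : grmod A) n (g : ghom (gpow 'I_n (greg A)) M) :
    torlin M -> injective (g 0) ->
    (forall j, 0 <= j -> forall m : M j, exists x, g j x = m) ->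
  torlin (gshift 1 (gker g)).
Proof.
move=> [M_neg van] ginj gsurj; split=> [j j0 x|h j hj].
  apply: val_inj; have [j1|j1] := leP 0 (j + 1); last first.
    by have := kvalP x; rewrite {1}/in_ker leNgt j1 => /eqP.
  have gx := kval_eq0 x j1.
  have ginj1 t : t = 0 -> injective (g t) by move=> ->.
  apply: (ginj1 (j + 1)); first by lia.
  by rewrite gx [RHS](lin0 (gfun_linear g j1)).
apply/torvan_gshift/torvan_gker => //; first exact: gpow_neg.
  by apply: van; lia.
by apply/torvan_gpow/torvan_greg; lia.
Qed.

Lemma findim_deg1 n : findim (gpow 'I_n (greg A) 1).
Proof.
have [p [v vspan]] := sg_fin A.
exact: (@findim_pow K (A 1) p v n vspan).
Qed.

Lemma torlin_linmod (M : grmod A) : torlin M -> findim (M 0) -> linmod M.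
Proof.
move=> torM finM; exists (fun M => torlin M /\ findim (M 0)) => // {torM finM}M.
move=> [torM /findim_basis[n [v [vind vspan]]]].
have gsurj := torlin_surj torM (ggen_surj0 vspan).
exists (ker_cover (ggen_inj vind) gsurj); split.
  by apply: torlin_gker => //; apply: ggen_inj.
apply: (@findim_inj _ _ _ (gker_inc (ggen v) 1 0)); last exact: findim_deg1.
  exact: (@gfun_linear _ _ _ _ (gker_inc (ggen v) 1) 0).
exact: val_inj.
Qed.
End TorVanishing.

(** * The residue field and the maximal ideal *)

Section ResidueField.
Variables (K : fieldType) (A : stdgr K).

Lemma resfield_eq0 j : j != 0 -> forall x : resfield A j, x = 0.
Proof. by move=> j0 x; apply: rsum_inj; rewrite !rsum_false. Qed.

Let one (k : 'I_1) : resfield A 0 := const_mx 1.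

Let one_spanning : spanning one.
Proof.
move=> x; exists (fun=> rsum (x : 'rV_(0 == 0 :> int))).
apply: rsum_inj; rewrite big_ord1 (linZ (@rsum_linear _ _)).
by rewrite rsum_const [RHS]mulr1.
Qed.

Let one_independent : independent one.
Proof.
move=> a; rewrite big_ord1 => /(congr1 (@rsum K (0 == 0 :> int))) a0 t.
rewrite (ord1 t); move: a0; rewrite [RHS](lin0 (@rsum_linear K _)).
by rewrite (linZ (@rsum_linear _ _)) rsum_const [LHS]mulr1.
Qed.

Let g := ggen one.
Let g_inj : injective (g 0) := ggen_inj one_independent.

(** The residue field satisfies the bound by hypothesis, and its syzygies are the
maximal ideal; in degrees >= 0, that is A(1) after the shift. *)
Lemma linmod_maxideal (F : grres (resfield A)) :
  (forall h j, h%:Z < j -> torvan (resfield A) F h j) ->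
  linmod (gshift 1 (greg A)).
Proof.
move=> van; have torK : torlin F (resfield A).
  by split=> // j j0; apply: resfield_eq0; rewrite lt_eqF.
have gsurj := torlin_surj torK (ggen_surj0 one_spanning).
have linN : linmod (gshift 1 (gker g)).
  apply: (torlin_linmod (torlin_gker torK g_inj gsurj)).
  apply: (@findim_inj _ _ _ (gker_inc g 1 0)); last exact: findim_deg1.
    exact: (@gfun_linear _ _ _ _ (gker_inc g 1) 0).
  exact: val_inj.
pose h : ghom (gshift 1 (gker g)) (gshift 1 (greg A)) :=
  @GHom K A (gshift 1 (gker g)) (gshift 1 (greg A)) (fun j x => kval x ord0)
   (fun j _ a x y => erefl) (fun i j k e a x _ _ => erefl).
apply: (linmod_iso (h := h)) linN => j j0.
have j1 : 0 <= j + 1 by lia.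
have wker (w : A (j + 1)) : in_ker g (fun=> w : greg A (j + 1)).
  by rewrite /in_ker j1; apply/eqP/resfield_eq0; lia.
exists (fun w => Kert (wker w)) => // x.
by apply: val_inj; apply/funext => i; rewrite /= (ord1 i).
Qed.

Lemma linmod_resfield : linmod (gshift 1 (greg A)) -> linmod (resfield A).
Proof.
pose f : ghom (gshift 1 (greg A)) (gshift 1 (gpow 'I_1 (greg A))) :=
  @GHom K A (gshift 1 (greg A)) (gshift 1 (gpow 'I_1 (greg A))) (fun j x => fun=> x)
   (fun j _ a x y => erefl) (fun i j k e a x _ _ => erefl).
have ex : @sexact _ (gm (gshift 1 (greg A))) (gm (gshift 1 (gpow 'I_1 (greg A))))
    (gm (gshift 1 (resfield A))) f (fun j => g (j + 1)).
  move=> j j0; have K0 : forall x : resfield A (j + 1), x = 0.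
    by apply: resfield_eq0; lia.
  split=> [x y /(congr1 (fun h => h ord0)) //|t|z].
    by exists 0; rewrite [LHS]K0 [RHS]K0.
  split=> [_|_]; last exact: K0.
  by exists (z ord0); apply/funext => i; rewrite /= (ord1 i).
exact: (linmodI (C := LinCover g_inj (ggen_surj0 one_spanning) ex)).
Qed.
End ResidueField.

(** * Regularity *)

(** Regularity 0 rules out that there is no resolution at all, since then every
Betti number is 0 by convention and the supremum is -oo. *)
Lemma koszul_torvan (K : fieldType) (A : stdgr K) : koszul A ->
  exists F : grres (resfield A), forall h j, h%:Z < j -> torvan (resfield A) F h j.
Proof.
rewrite /koszul /reg /supremum; case: ifPn => [_ /eqP//|/set0P ne].
case: xgetP => [r _ [ub _] r0|_ /eqP//]; rewrite {}r0 in ub.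
move: ne ub; rewrite /betti; case: pselect => [F|noF] ne ub; last first.
  by case: ne => z [i [j []]].
exists (unsquash F) => h j hj; apply/tordim_torvan/eqP/negP => /negP/eqP bhj.
have : ((j - h%:Z)%:E <= 0 :> \bar int)%E by apply: ub; exists h, j.
by rewrite lee_fin; lia.
Qed.

Section LinearBetti.
Variables (K : fieldType) (A : stdgr K) (M : grmod A).
Hypothesis linM : linmod M.
Hypothesis M_neg : forall j, j < 0 -> forall x : M j, x = 0.
Hypothesis linK : linmod (resfield A).

(** The bound is obvious for the linear resolution L of M, because its i-th term
tensored with K is concentrated in degree i. *)
Lemma torvan_linear (G : grres M) (i : nat) (j : int) :
  j != i%:Z -> torvan (resfield A) G i j.
Proof.
move=> ij; have [L Ldeg] := linmod_resolution linM M_neg.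
have [|F _] := linmod_resolution linK.
  by move=> k k0; apply: resfield_eq0; rewrite lt_eqF.
apply: (torvan_balance (F := F)); apply: (torvan_balance (F := L)).
move=> x _; exists (fun k => 0) => l; rewrite [RHS]resfield_eq0.
  by rewrite [LHS]resfield_eq0 // Ldeg subr_eq0.
by rewrite Ldeg subr_eq0.
Qed.

(** In the linear resolution, K (x) L_1 vanishes in degree 0, so the generators
of L_0 survive. *)
Lemma torvan_nonzero (G : grres M) : nonzero_mod M -> ~ torvan (resfield A) G 0 0.
Proof.
move=> [j [m m0]] van; have [L Ldeg] := linmod_resolution linM M_neg.
have [|F _] := linmod_resolution linK.
  by move=> k k0; apply: resfield_eq0; rewrite lt_eqF.
have {}van : torvan (resfield A) L 0 0.
  by apply: (torvan_balance (F := F)); apply: (torvan_balance (F := G)).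
have [x xm] := fsurj L m.
have [k] : inhabited 'I_(frk L 0).
  apply: contra_notP m0 => noI; rewrite -xm /fraug big1 // => k _.
  by case: noI; exists.
have [y yE] := van (fun l => const_mx 1) I.
have /eqP : rsum (const_mx 1 : 'rV[K]_(0 - fdeg L 0 k == 0)) = 1.
  by rewrite rsum_const Ldeg.
suff -> : const_mx 1 = 0 :> resfield A (0 - fdeg L 0 k).
  by rewrite (lin0 (@rsum_linear K _)) eq_sym oner_eq0.
rewrite -(yE k) [LHS]big1 // => t _; rewrite (resfield_eq0 _ (y t)) ?gact0 //.
by rewrite Ldeg subr_eq0.
Qed.

Lemma betti_linear (i : nat) (j : int) : j != i%:Z -> betti M i j = 0%N.
Proof.
by rewrite /betti => ij; case: pselect => // G; apply/tordim_torvan/torvan_linear.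
Qed.

Lemma betti_nonzero : nonzero_mod M -> betti M 0 0 <> 0%N.
Proof.
rewrite /betti; case: pselect => [G M0 /tordim_torvan|noG]; first exact: torvan_nonzero.
by have [L _] := linmod_resolution linM M_neg; case: noG; apply: squash.
Qed.

Lemma linmod_linear_resolution : linear_resolution M.
Proof.
by exists 0 => i j /eqP; rewrite add0r; apply: betti_linear.
Qed.

Lemma linmod_reg : nonzero_mod M -> reg M = 0%E.
Proof.
move=> M0; rewrite /reg.
suff -> : [set z | exists (i : nat) (j : int),
      betti M i j <> 0%N /\ z = (j - i%:Z)%:E]%classic
    = [set 0%E]%classic by apply: supremum1.
apply/seteqP; split=> [z [i [j [bij ->]]]|_ ->] /=.
  have [->|ij] := eqVneq j i%:Z; first by rewrite subrr.
  by rewrite betti_linear in bij.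
exists 0%N, 0; split; [exact: betti_nonzero | by rewrite subrr].
Qed.
End LinearBetti.

(** * Veronese modules of Koszul algebras *)

Section VeroneseModules.
Variables (K : fieldType) (R : stdgr K) (c : nat) (c_gt0 : (0 < c)%N).
Hypothesis linR1 : linmod (gshift 1 (greg R)).
Local Notation A := (veronese R c_gt0).

Lemma linmod_vermod u : linmod (vermod R c_gt0 u).
Proof.
pose h : ghom (gver c_gt0 (gshift u%:Z (greg R))) (vermod R c_gt0 u) :=
  @GHom K A (gver c_gt0 (gshift u%:Z (greg R))) (vermod R c_gt0 u)
    (fun j x => x) (fun j _ a x y => erefl)
    (fun i j k e a x _ _ => congr1 (fun e => gmul R e a x) (eq_irrelevance _ _)).
apply: (linmod_iso (h := h)); first by move=> j _; exists id.
by apply/linmod_ver/linmod_shift => //; apply: linmod_greg.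
Qed.

(** The truncation of R to degrees >= c has this ideal, shifted, as its Veronese
module. *)
Lemma linmod_veronese_maxideal : linmod (gshift 1 (greg A)).
Proof.
pose N := gver c_gt0 (gshift c%:Z (greg R)).
have d (j : int) : j * c%:Z + c%:Z = (j + 1) * c%:Z by rewrite mulrDl mul1r.
have hact i j k (e : i + j = k) (a : A i) (x : N j) : 0 <= i -> 0 <= j ->
    tr (V := R) (d k) (gact N e a x) = gact (gshift 1 (greg A)) e a (tr (V := R) (d j) x).
  move=> _ _; have e' : i * c%:Z + (j * c%:Z + c%:Z) = (k + 1) * c%:Z.
    by rewrite d -mulrDl addrA e.
  rewrite [LHS](@tr_gact K R (greg R) _ _ _ _ _ e').
  by rewrite [RHS](@gact_tr K R (greg R) _ _ _ _ e').
pose h : ghom N (gshift 1 (greg A)) := @GHom K A N (gshift 1 (greg A))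
  (fun j => tr (V := R) (d j)) (fun j _ => @tr_linear K R _ _ (d j)) hact.
apply: (linmod_iso (h := h)).
  by move=> j _; exists (tr (V := R) (esym (d j))); apply: trK.
by apply/linmod_ver/linmod_shift => //; apply: linmod_greg.
Qed.
End VeroneseModules.

Theorem theorem3p3 (K : fieldType) (R : stdgr K) (c : nat) (c_gt0 : (0 < c)%N) :
  koszul R ->
  koszul (veronese R c_gt0) /\
  (forall u : nat, (u < c)%N ->
     (nonzero_mod (vermod R c_gt0 u) -> reg (vermod R c_gt0 u) = 0%E) /\
     linear_resolution (vermod R c_gt0 u)).
Proof.
move=> /koszul_torvan[F /linmod_maxideal linR1].
have linK := linmod_resfield (linmod_veronese_maxideal c_gt0 linR1).
split=> [|u uc].
  apply: linmod_reg => //; first by move=> j j0; apply: resfield_eq0; rewrite lt_eqF.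
  exists 0, (const_mx 1) => /(congr1 (@rsum K (0 == 0 :> int))).
  by rewrite rsum_const [RHS](lin0 (@rsum_linear K _)) => /eqP; rewrite oner_eq0.
have linV := linmod_vermod c_gt0 linR1 u.
have Vneg j : j < 0 -> forall x : vermod R c_gt0 u j, x = 0.
  by move=> j0; apply: sg_neg; nia.
by split; [apply: linmod_reg | apply: linmod_linear_resolution].
Qed.
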